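(* Let $n\ge 1$ be an integer, $0<\alpha<n$, $\nu>r>\frac{n}{n-\alpha}$, and $R_2>R_1>0$. Let $V\in L^{\frac n\alpha}(B_{R_2})$ with $V\ge 0$, $h\in L^\nu(B_{R_1})$, and $u\in L^r(B_{R_2})$ with $u\ge 0$ satisfy $$u(x)\le\int_{B_{R_2}}\frac{V(y)u(y)}{|x-y|^{n-\alpha}}\,dy+h(x),\qquad x\in B_{R_1}.$$ Then, for some $\epsilon>0$, $u\in L^\nu(B_\epsilon)$.
   Context: $B_R$ denotes the ball of radius $R$ in $\mathbb{R}^n$ centered at the origin. *)

(* Defs.v *)
From HB Require Import structures.
From mathcomp Require Import all_boot all_order all_algebra.
From mathcomp Require Import all_classical all_reals all_analysis.

Set Implicit Arguments.
Unset Strict Implicit.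
Unset Printing Implicit Defensive.
Import Order.TTheory GRing.Theory Num.Theory.
Import numFieldNormedType.Exports.

Local Open Scope classical_set_scope.
Local Open Scope ring_scope.

(* R^n as tuples: the library puts the product sigma-algebra (here the Borel
   sets of R^n) on [n.-tuple T], but no sigma-algebra on ['rV[R]_n]. *)
Notation Rn R n := (n.-tuple (measurableTypeR R)).

Section euclidean_space.
Context {R : realType}.

(* The library's norm on ['rV[R]_n] is the sup norm, hence this one. *)
Definition eucl_norm n (x : Rn R n) : R :=
  Num.sqrt (\sum_(i < n) (tnth x i : R) ^+ 2).

Definition eucl_dist n (x y : Rn R n) : R :=
  eucl_norm [tuple (tnth x i : R) - tnth y i | i < n].

Definition eucl_ball n (r : R) : set (Rn R n) := [set x | eucl_norm x < r].

Definition rn_cons n (p : Rn R n * measurableTypeR R) : Rn R n.+1 :=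
  [tuple of p.2 :: p.1].

Lemma measurable_rn_cons n : measurable_fun [set: _] (@rn_cons n).
Proof. exact: measurable_cons measurable_snd measurable_fst. Qed.

Definition lebesgue_rnS n (m : {measure set (Rn R n) -> \bar R}) :
  {measure set (Rn R n.+1) -> \bar R}.
Proof.
refine [the {measure set (Rn R n.+1) -> \bar R} of
  pushforward (m \x lebesgue_measure)%E (@rn_cons n)].
exact: measurable_rn_cons.
Defined.

(* n-dimensional Lebesgue measure, as the n-fold product of the Lebesgue
   measure on the line; see [lebesgue_rn_box]. *)
Fixpoint lebesgue_rn n : {measure set (Rn R n) -> \bar R} :=
  match n with
  | 0 => \d_([tuple] : Rn R 0)
  | n'.+1 => lebesgue_rnS (lebesgue_rn n')
  end.

Lemma lebesgue_rnSE n (A : set (Rn R n.+1)) :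
  lebesgue_rn n.+1 A
  = (lebesgue_rn n \x lebesgue_measure)%E (@rn_cons n @^-1` A).
Proof. by []. Qed.

Lemma lebesgue_rn_box n (A : 'I_n -> set (measurableTypeR R)) :
  (forall i, measurable (A i)) ->
  lebesgue_rn n [set x : Rn R n | forall i, A i (tnth x i)]
  = (\prod_(i < n) lebesgue_measure (A i))%E.
Proof.
elim: n A => [|n IHn] A mA.
  rewrite big_ord0 /= diracE mem_set//=.
  by case.
rewrite lebesgue_rnSE big_ord_recl.
have -> : @rn_cons n @^-1` [set x | forall i, A i (tnth x i)]
  = [set x : Rn R n | forall i, A (lift ord0 i) (tnth x i)] `*` A ord0.
  apply/seteqP; split => -[x t] /= Ax.
    split=> [i|]; last exact: (Ax ord0).
    by have := Ax (lift ord0 i); rewrite tnthS.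
  case: Ax => Ax At i.
  by case: (unliftP ord0 i) => [j ->|->//]; rewrite tnthS.
rewrite product_measure1E//.
  by rewrite (IHn (fun i => A (lift ord0 i)))// muleC.
rewrite [X in measurable X](_ : _ = \bigcap_(i in [set: 'I_n])
  (fun x : Rn R n => tnth x i) @^-1` A (lift ord0 i)); last first.
  apply/seteqP; split => x /= Ax i; first by move=> _; exact: Ax.
  exact: (Ax i I).
apply: fin_bigcap_measurable => [|i _]; first exact: finite_finset.
rewrite -[X in measurable X]setTI.
exact: measurable_tnth.
Qed.

(* f is in L^p(A): [Lfun] asks for (Borel) measurability and a finite L^p-norm,
   and [f \_ A] is f on A and 0 elsewhere, so only the values on A matter.
   As elements of L^p are classes modulo a.e. equality, each of them has a
   Borel, everywhere finite representative. *)
Definition Lp_on n (p : R) (A : set (Rn R n)) (f : Rn R n -> R) : Prop :=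
  f \_ A \in Lfun (lebesgue_rn n) p%:E.

End euclidean_space.
Arguments eucl_ball {R} n r.
Arguments lebesgue_rn {R} n.

(* Main.v *)
(** Write [a = alpha / n] and [m x y = |x - y| ^ n], so that the balls
    [{y | m x y < t}] have measure [O(t)] and the kernel is [m ^ (a - 1)].

    Hardy-Littlewood-Sobolev: after normalizing [int F = int G = 1], put
    [X = F(x) m] and [Y = G(y) m].  For [0 < a, b < 1 < a + b],
    [X^a Y^b <= X Y + min (X^a) (X^(a+b)) + min (Y^b) (Y^(a+b))]; divided by
    [m ^ 2] this bounds [F(x)^a G(y)^b m^(a+b-2)] by three terms with bounded
    integrals.  By duality and Hoelder, [w |-> int V w m^(a-1)] is bounded on every
    [L^q] with [a + 1/q < 1], with norm [O(|V|_(1/a))].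

    Localization: let [omega = max 0 (t - |x|) ^ s] with [s = n (1/r - 1/nu)].
    Since [omega x <= 2^s (omega y + C |x - y|^s)], the function [W = omega u]
    satisfies [W <= S W + H], where [S] has the potential of [V] restricted to
    [{|x| < t}], hence small norm on [L^r] and on [L^nu] for small [t], and where
    the gain of [s] derivatives in the second term puts [H] in [L^nu].
    Iterating, [W] is dominated by [w1 + w2] with [w1] arbitrarily small in [L^r]
    and [w2] bounded in [L^nu], which forces [W] into [L^nu]. *)
From HB Require Import structures.
Require Import Defs.
From mathcomp Require Import all_boot all_order all_algebra.
From mathcomp Require Import all_classical all_reals all_analysis.
From mathcomp Require Import ring lra measurable_realfun.
Import Order.TTheory GRing.Theory Num.Theory.
Import numFieldNormedType.Exports.
Local Open Scope classical_set_scope.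
Local Open Scope ring_scope.

(** * Inequalities between real powers *)

Section powR_extra.
Context {R : realType}.
Implicit Types a b p x y X Y : R.

Lemma ler_powR2l p x y : 0 <= p -> 0 <= x -> x <= y -> x `^ p <= y `^ p.
Proof.
by move=> p0 x0 xy; rewrite ge0_ler_powR// nnegrE// (le_trans x0 xy).
Qed.

Lemma ler_powR2l_neg p x y : p <= 0 -> 0 < x -> x <= y -> y `^ p <= x `^ p.
Proof.
move=> p0 x0 xy; rewrite -[p]opprK !(powRN _ (- p)).
rewrite lef_pV2 ?posrE ?powR_gt0 ?(lt_le_trans x0 xy)//.
by apply: ler_powR2l; rewrite ?oppr_ge0// ltW.
Qed.

Lemma powRD_le p x y : 0 <= p -> 0 <= x -> 0 <= y ->
  (x + y) `^ p <= 2 `^ p * (x `^ p + y `^ p).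
Proof.
move=> p0; wlog xy : x y / x <= y => [hwlog x0 y0|x0 y0].
  have [/hwlog|/ltW/hwlog] := leP x y; first exact.
  by rewrite [y + x]addrC [y `^ p + _]addrC; exact.
apply: (@le_trans _ _ ((2 * y) `^ p)).
  by apply: ler_powR2l => //; [exact: addr_ge0|rewrite mulr2n mulrDl mul1r lerD].
by rewrite powRM// ler_wpM2l ?powR_ge0// lerDr powR_ge0.
Qed.

Lemma powR_exprn x (p : R) n : 0 <= x -> (x ^+ n) `^ p = (x `^ p) ^+ n.
Proof. by move=> x0; rewrite -powR_mulrn// powRAC powR_mulrn ?powR_ge0. Qed.

Lemma powRDpos x a b : 0 < x -> x `^ (a + b) = x `^ a * x `^ b.
Proof. by move=> x0; rewrite powRD//; apply/implyP => _; rewrite gt_eqF. Qed.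

Lemma dyadic_bracket x : 1 <= x -> exists j : nat, 2 ^+ j <= x < 2 ^+ j.+1.
Proof.
move=> x1.
have ex : exists j : nat, x < 2 ^+ j.+1.
  exists (Num.truncn x); rewrite (lt_le_trans (truncnS_gt x))//.
  by rewrite -natrX ler_nat ltnW// ltn_expl.
case: (ex_minnP ex) => j jx jmin; exists j; rewrite jx andbT.
case: j jmin {jx} => [//|j jmin].
by rewrite leNgt; apply/negP => /jmin; rewrite ltnn.
Qed.

(* The four cases according to whether [X] and [Y] exceed 1. *)
Lemma powR_prod_le a b X Y : 0 < a < 1 -> 0 < b < 1 -> 0 <= X -> 0 <= Y ->
  X `^ a * Y `^ b <= X * Y + Num.min (X `^ a) (X `^ (a + b))
                           + Num.min (Y `^ b) (Y `^ (a + b)).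
Proof.
move=> /andP[a0 a1] /andP[b0 b1] X0 Y0.
have minX_ge0 c d Z : 0 <= Num.min (Z `^ c : R) (Z `^ d).
  by rewrite le_min !powR_ge0.
have [X1|X1] := leP 1 X; have [Y1|Y1] := leP 1 Y.
- rewrite -addrA (@le_trans _ _ (X * Y))//; last by rewrite lerDl addr_ge0.
  by rewrite ler_pM ?powR_ge0 ?ler1_powR// ltW.
- rewrite -addrA addrCA (@le_trans _ _ (X `^ a))//; last first.
    rewrite (min_idPl _) ?lerDl ?addr_ge0 ?mulr_ge0//.
    by rewrite ler_powR// lerDl ltW.
  rewrite ler_piMr ?powR_ge0// -[leRHS](congr1 (fun f => f b) (powR1 R)) ler_powR2l//; exact: ltW.
- rewrite (@le_trans _ _ (Y `^ b))//; last first.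
    rewrite [X in _ + X](min_idPl _) ?lerDr ?addr_ge0 ?mulr_ge0//.
    by rewrite ler_powR// lerDr ltW.
  rewrite ler_piMl ?powR_ge0// -[leRHS](congr1 (fun f => f a) (powR1 R)) ler_powR2l//; exact: ltW.
(* Both are below 1. By symmetry [Y <= X], so [Y ^ b <= X ^ b] and the product is at most
   [X ^ (a + b)], which is the minimum because [X < 1]. *)
wlog XY : a b X Y a0 a1 b0 b1 X0 Y0 X1 Y1 / Y <= X => [hwlog|].
  have [XY|/ltW XY] := leP Y X; first exact: hwlog.
  rewrite mulrC [X * Y]mulrC addrAC [a + b]addrC.
  exact: hwlog.
have [->|Xn0] := eqVneq X 0.
  by rewrite powR0 ?gt_eqF// mul0r mul0r add0r addr_ge0.
have Xp : 0 < X by rewrite lt_neqAle eq_sym Xn0.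
rewrite (@le_trans _ _ (X `^ (a + b)))//.
  rewrite powRDpos// ler_wpM2l ?powR_ge0// ler_powR2l//; exact: ltW.
rewrite (min_idPr _); last first.
  by rewrite ger_powR ?Xp ?ltW// ltrDl.
by rewrite addrAC lerDr addr_ge0 ?mulr_ge0.
Qed.

(* [powR_prod_le] with [X = F z] and [Y = G z], divided by [z ^ 2]. *)
Lemma powR_kernel_le a b (F G z : R) : 0 < a < 1 -> 0 < b < 1 ->
  0 <= F -> 0 <= G -> 0 <= z ->
  F `^ a * G `^ b * z `^ (a + b - 2) <= F * G
    + Num.min (F `^ a * z `^ (a - 2)) (F `^ (a + b) * z `^ (a + b - 2))
    + Num.min (G `^ b * z `^ (b - 2)) (G `^ (b + a) * z `^ (b + a - 2)).
Proof.
move=> a01 b01 F0 G0.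
have [a0 a1] := andP a01; have [b0 b1] := andP b01.
have e1 : a + b - 2 != 0 by apply: ltr0_neq0; lra.
have e2 : b + a - 2 != 0 by apply: ltr0_neq0; lra.
have e3 : a - 2 != 0 by apply: ltr0_neq0; lra.
have e4 : b - 2 != 0 by apply: ltr0_neq0; lra.
(* By convention [powR] sends 0 to 0 for every nonzero exponent, negative ones included, so all
   kernel terms vanish at [z = 0]. *)
rewrite le_eqVlt => /predU1P[<-|z0].
  by rewrite !(powR0 e1, powR0 e2, powR0 e3, powR0 e4) !mulr0 minxx !addr0 mulr_ge0.
have FzM e w : 0 <= w -> w `^ e * z `^ (e - 2) = z `^ (- 2) * (w * z) `^ e.
  by move=> w0; rewrite powRM ?(ltW z0)// powRDpos//; ring.
have minM x y : Num.min (z `^ (- 2) * x) (z `^ (- 2) * y)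
    = z `^ (- 2) * Num.min x y.
  by rewrite minr_pMr ?powR_ge0.
rewrite !FzM// !minM [b + a]addrC.
have -> : F * G = z `^ (- 2) * (F * z * (G * z)).
  by rewrite powRN powR_mulrn ?(ltW z0)//; field; rewrite gt_eqF.
have -> : F `^ a * G `^ b * z `^ (a + b - 2)
    = z `^ (- 2) * ((F * z) `^ a * (G * z) `^ b).
  by rewrite !powRM ?(ltW z0)// !powRDpos//; ring.
by rewrite -!mulrDr ler_wpM2l ?powR_ge0// powR_prod_le// mulr_ge0// ltW.
Qed.

End powR_extra.

Lemma measurable_fun_powR d (T : measurableType d) (R : realType) (f : T -> R)
    (D : set T) p :
  measurable_fun D f -> measurable_fun D (fun x => f x `^ p).
Proof. exact: (measurableT_comp (measurable_powR p)). Qed.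

(** * Integrals of powers: truncation and Hoelder's inequality *)

Section integral_powR.
Context d (T : measurableType d) (R : realType).
Variable mu : {measure set T -> \bar R}.

(** Monotone convergence in [k]. This serves the estimates whose argument needs a bounded function,
    or an integral known to be finite. *)
Lemma integral_powR_trunc_le (j : T -> R) (p : R) (C : \bar R) : 0 < p ->
  measurable_fun setT j -> (forall x, 0 <= j x) ->
  (forall k : nat, \int[mu]_x (Num.min (j x) k%:R `^ p)%:E <= C)%E ->
  (\int[mu]_x (j x `^ p)%:E <= C)%E.
Proof.
move=> p0 mj j0 jC.
pose f (k : nat) x := (Num.min (j x) k%:R `^ p)%:E.
have mf k : measurable_fun setT (f k).
  apply/measurable_EFinP; apply: measurable_fun_powR.
  exact: measurable_minr.
have nd x : setT x -> {homo f ^~ x : k l / (k <= l)%N >-> (k <= l)%E}.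
  move=> _ k l kl; rewrite lee_fin ler_powR2l ?(ltW p0) ?le_min ?j0 ?ler0n//.
  by rewrite ge_min lexx/= ge_min ler_nat kl orbT.
have cvgf x : f ^~ x @ \oo --> (j x `^ p)%:E.
  apply: cvg_near_cst; near=> k.
  by rewrite /f (min_idPl _)//; near: k; exact: nbhs_infty_ger.
have -> : (\int[mu]_x (j x `^ p)%:E = \int[mu]_x limn (f ^~ x))%E.
  by apply: eq_integral => x _; apply/esym/cvg_lim.
rewrite monotone_convergence//; last by move=> k x _; rewrite lee_fin powR_ge0.
apply: lime_le; last by apply: nearW => k; exact: jC.
apply: ereal_nondecreasing_is_cvgn => k l kl; apply: ge0_le_integral => //.
- by move=> x _; rewrite lee_fin powR_ge0.
- by move=> x _; exact: nd.
Unshelve. all: by end_near. Qed.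

Lemma integral_powR_lty (f : T -> R) (p : R) :
  (\int[mu]_x (f x `^ p)%:E < +oo)%E ->
  exists2 M : R, 0 < M & (\int[mu]_x (f x `^ p)%:E <= M%:E)%E.
Proof.
have I0 : (0 <= \int[mu]_x (f x `^ p)%:E)%E.
  by apply: integral_ge0 => x _; rewrite lee_fin powR_ge0.
move=> foo; exists (fine (\int[mu]_x (f x `^ p)%:E) + 1).
  by rewrite ltr_wpDl// fine_ge0.
by rewrite EFinD fineK ?leeDl// ge0_fin_numE.
Qed.

Lemma powR_young (P Q s t : R) : 0 <= P -> 0 <= Q -> 0 < s -> 0 < t ->
  s + t = 1 -> P `^ s * Q `^ t <= s * P + t * Q.
Proof.
move=> P0 Q0 s0 t0 st.
have := @conjugate_powR R (P `^ s) (Q `^ t) s^-1 t^-1 (powR_ge0 _ _) (powR_ge0 _ _).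
rewrite !invr_gt0 !invrK => /(_ s0 t0 st); rewrite -!powRrM !mulfV ?gt_eqF//.
by rewrite !powRr1// [P * s]mulrC [Q * t]mulrC.
Qed.

(** Integrate the weighted Young inequality for [P / A] and [Q / B], multiplied by [A ^ s * B ^ t];
    the weights add up to 1. *)
Lemma integral_powR_hoelder (P Q : T -> R) (s t A B : R) : 0 < s -> 0 < t ->
  s + t = 1 -> 0 < A -> 0 < B ->
  measurable_fun setT P -> measurable_fun setT Q ->
  (forall x, 0 <= P x) -> (forall x, 0 <= Q x) ->
  (\int[mu]_x (P x)%:E <= A%:E)%E -> (\int[mu]_x (Q x)%:E <= B%:E)%E ->
  (\int[mu]_x (P x `^ s * Q x `^ t)%:E <= (A `^ s * B `^ t)%:E)%E.
Proof.
move=> s0 t0 st A0 B0 mP mQ P0 Q0 PA QB.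
pose K := A `^ s * B `^ t.
have K0 : 0 <= K by rewrite mulr_ge0 ?powR_ge0.
have sA : 0 <= K * s / A := divr_ge0 (mulr_ge0 K0 (ltW s0)) (ltW A0).
have tB : 0 <= K * t / B := divr_ge0 (mulr_ge0 K0 (ltW t0)) (ltW B0).
apply: (@le_trans _ _ (\int[mu]_x ((K * s / A)%:E * (P x)%:E
                                  + (K * t / B)%:E * (Q x)%:E))%E).
  apply: ge0_le_integral => //.
  - by move=> x _; rewrite lee_fin mulr_ge0 ?powR_ge0.
  - by apply/measurable_EFinP; apply: measurable_funM; exact: measurable_fun_powR.
  - by apply/measurable_EFinP; apply: measurable_funD; exact: measurable_funM.
  move=> x _; rewrite -!EFinM -EFinD lee_fin.
  have PA0 : 0 <= A^-1 * P x by rewrite mulr_ge0// invr_ge0 ltW.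
  have QB0 : 0 <= B^-1 * Q x by rewrite mulr_ge0// invr_ge0 ltW.
  have := ler_wpM2l K0 (powR_young _ _ _ _ PA0 QB0 s0 t0 st).
  rewrite !powRM ?invr_ge0 ?(ltW A0) ?(ltW B0)//.
  rewrite -!powR_inv1 ?(ltW A0) ?(ltW B0)// -!powRrM !mulN1r !powRN.
  rewrite !powRr1 ?(ltW A0) ?(ltW B0)//.
  suff -> : K * ((A `^ s)^-1 * P x `^ s * ((B `^ t)^-1 * Q x `^ t)) =
     P x `^ s * Q x `^ t.
    by move=> /le_trans; apply; rewrite le_eqVlt; apply/orP; left; apply/eqP; ring.
  by rewrite /K; field; rewrite !gt_eqF ?powR_gt0.
rewrite ge0_integralD//; last 4 first.
- by move=> x _; rewrite -EFinM lee_fin mulr_ge0.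
- by apply/measurable_EFinP; exact: measurable_funM.
- by move=> x _; rewrite -EFinM lee_fin mulr_ge0.
- by apply/measurable_EFinP; exact: measurable_funM.
rewrite !ge0_integralZl_EFin//; last 4 first.
- by move=> x _; rewrite lee_fin.
- exact/measurable_EFinP.
- by move=> x _; rewrite lee_fin.
- exact/measurable_EFinP.
apply: (@le_trans _ _ ((K * s / A)%:E * A%:E + (K * t / B)%:E * B%:E)%E).
  by apply: leeD; apply: lee_wpmul2l.
rewrite -!EFinM -EFinD lee_fin !divfK ?gt_eqF//.
by rewrite -mulrDr st mulr1.
Qed.

End integral_powR.

(** * Domination by a geometric series of integrals *)

Section geometric_cover.
Context d (T : measurableType d) (R : realType).
Variable mu : {measure set T -> \bar R}.

Lemma nneseries_geometric (K q : R) : 0 <= K -> 0 < q < 1 ->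
  (\sum_(j <oo) (K * q ^+ j)%:E = (K / (1 - q))%:E)%E.
Proof.
move=> K0 /andP[q0 q1]; apply/cvg_lim => //.
apply: cvg_EFin; first by apply: nearW => k; rewrite sumEFin.
have -> : fine \o (fun n => \sum_(0 <= j < n) (K * q ^+ j)%:E)%E
    = series (geometric K q).
  by apply/funext => k /=; rewrite sumEFin.
by apply: cvg_geometric_series; rewrite ger0_norm// ltW.
Qed.

(** At each point a single [g j] dominates [f], and the others are nonnegative, so [f] is below the
    sum of all of them; exchange sum and integral. *)
Lemma integral_geometric_cover (f : T -> R) (g : nat -> T -> R) (K q : R) :
  0 <= K -> 0 < q < 1 ->
  measurable_fun setT f -> (forall y, 0 <= f y) ->
  (forall j, measurable_fun setT (g j)) -> (forall j y, 0 <= g j y) ->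
  (forall y, exists j, f y <= g j y) ->
  (forall j, \int[mu]_y (g j y)%:E <= (K * q ^+ j)%:E)%E ->
  (\int[mu]_y (f y)%:E <= (K / (1 - q))%:E)%E.
Proof.
move=> K0 q01 mf f0 mg g0 fg gK.
rewrite -nneseries_geometric//.
apply: (@le_trans _ _ (\sum_(j <oo) \int[mu]_y (g j y)%:E)%E); last first.
  apply: lee_nneseries => // j _ _.
  by apply: integral_ge0 => y _; rewrite lee_fin.
rewrite -integral_nneseries//; last 2 first.
- by move=> j; apply/measurable_EFinP.
- by move=> j y _; rewrite lee_fin.
apply: ge0_le_integral => //.
- by move=> y _; rewrite lee_fin.
- exact/measurable_EFinP.
- apply: ge0_emeasurable_sum => [j y _ _|j _]; first by rewrite lee_fin.
  exact/measurable_EFinP.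
move=> y _; have [j fj] := fg y.
apply: (@le_trans _ _ (g j y)%:E); first by rewrite lee_fin.
apply: le_trans (nneseries_lim_ge j.+1 _) => [|k _ _]; last by rewrite lee_fin.
rewrite big_nat_recr//= leeDr// sume_ge0// => k _.
by rewrite lee_fin.
Qed.

End geometric_cover.

(** * Kernels [m] whose balls [m x y < t] have measure at most [c * t]; mass of the truncated
    kernel *)

Section fractional_integral.
Context d (T : measurableType d) (R : realType).
Variable mu : {sigma_finite_measure set T -> \bar R}.
Variables (m : T -> T -> R) (c : R).
Hypothesis c0 : 0 < c.
Hypothesis m_ge0 : forall x y, 0 <= m x y.
Hypothesis mC : forall x y, m x y = m y x.
Hypothesis mm : measurable_fun setT (fun z : T * T => m z.1 z.2).
Hypothesis mball : forall x (t : R), 0 < t ->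
  (mu [set y | (m x y < t)%R] <= (c * t)%:E)%E.

Let mm1 x : measurable_fun setT (m x).
Proof. exact: (measurableT_comp mm (measurable_pair1 x)). Qed.

Let measurable_mball x t : measurable [set y | (m x y < t)%R].
Proof.
rewrite [X in measurable X](_ : _ = (m x) @^-1` `]-oo, t[%classic); last first.
  by apply/seteqP; split => y /=; rewrite in_itv.
by rewrite -[X in measurable X]setTI; exact: mm1.
Qed.

Lemma measurable_powm p : measurable_fun setT (fun z : T * T => m z.1 z.2 `^ p).
Proof. exact: (measurableT_comp (measurable_powR p) mm). Qed.

Let integral_mball x (t k : R) : 0 < t -> 0 <= k ->
  (\int[mu]_y (k * \1_[set y | (m x y < t)%R] y)%:E <= (k * (c * t))%:E)%E.
Proof.
move=> t0 k0; under eq_integral do rewrite EFinM.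
rewrite ge0_integralZl_EFin//; last exact/measurable_EFinP/measurable_indic.
by rewrite integral_indic// setIT EFinM lee_wpmul2l// mball.
Qed.

Section kernel_mass.
Variables a b : R.

(** [q] is the larger ratio of the two dyadic series in [kernel_mass], over [F m >= 1] and over
    [F m <= 1]. Their factors are 2 and at most 4, hence the 6. *)
Definition kernel_mass_const : R :=
  let q : R := Num.max (2 `^ (a - 1)) (2 `^ (1 - a - b)) in 6 * c / (1 - q).

Lemma kernel_mass_const_ge0 : 0 < a < 1 -> 0 < b < 1 -> 1 < a + b ->
  0 <= kernel_mass_const.
Proof.
move=> /andP[a0 a1] /andP[b0 b1] ab1; rewrite /kernel_mass_const.
have p2le1 (e : R) : e <= 0 -> 2 `^ e <= 1.
  by move=> e0; rewrite -[leRHS](powRr0 2) ler_powR ?ler1n.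
rewrite divr_ge0 ?mulr_ge0 ?(ltW c0)// subr_ge0 ge_max !p2le1 ?subr_le0 ?(ltW a1)//.
by move: ab1 => /ltW ab1; lra.
Qed.

(* [F ^ 2 * min ((F m) ^ (a - 2)) ((F m) ^ (a + b - 2))], which is
   [min (X ^ a) (X ^ (a + b)) / m ^ 2] for [X = F m]. *)
Lemma kernel_mass x (F : R) : 0 < a < 1 -> 0 < b < 1 -> 1 < a + b -> 0 <= F ->
  (\int[mu]_y (Num.min (F `^ a * m x y `^ (a - 2))
               (F `^ (a + b) * m x y `^ (a + b - 2)))%:E
   <= (kernel_mass_const * F)%:E)%E.
Proof.
move=> /andP[a0 a1] /andP[b0 b1] ab1.
have ab0 : 0 < a + b by exact: addr_gt0.
have am2 : a - 2 < 0 by lra.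
have abm2 : a + b - 2 < 0 by lra.
have [-> _|Fn0 F0] := eqVneq F 0.
  rewrite !powR0 ?gt_eqF//; under eq_integral do rewrite !mul0r minxx.
  by rewrite integral0 mulr0.
have Fp : 0 < F by rewrite lt_neqAle eq_sym Fn0.
rewrite /kernel_mass_const; set q := Num.max _ _.
have p2 e : 0 < (2 : R) `^ e by rewrite powR_gt0.
have p2lt1 (e : R) : e < 0 -> 2 `^ e < 1.
  by move=> e0; rewrite -[ltRHS](powRr0 2) /powR pnatr_eq0/= ltr_expR mul0r
     nmulr_rlt0// ln_gt0// ltr1n.
have q01 : 0 < q < 1.
  have ab_lt0 : 1 - a - b < 0 by lra.
  by rewrite lt_max p2/= gt_max !p2lt1// subr_lt0.
(* Dyadic layers of [X = F m]. The first term serves [2^j <= X < 2^(j+1)], the second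
   [2^-(j+1) <= X <= 2^-j]. Both exponents are negative, so the power is largest at the lower end of
   the layer, and the indicator keeps only the upper end. The doubled radius in the second indicator
   makes its inequality strict. *)
pose g j y : R := F ^+ 2 * (2 ^+ j) `^ (a - 2) *
    \1_[set y | (m x y < 2 ^+ j.+1 / F)%R] y +
  F ^+ 2 * (2 ^+ j.+1)^-1 `^ (a + b - 2) *
    \1_[set y | (m x y < 2 / 2 ^+ j / F)%R] y.

have powFm p z : 0 <= z -> F `^ p * z `^ (p - 2) = F ^+ 2 * (F * z) `^ (p - 2).
  move=> z0; rewrite (powRM _ F0 z0) mulrA -(powR_mulrn 2 F0) -powRDpos//.
  by rewrite addrCA subrr addr0.
have ind1 t y : m x y < t -> \1_[set y | (m x y < t)%R] y = 1 :> R.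
  by move=> h; rewrite indicE mem_set.
rewrite mulrAC.
pose f y : R := Num.min (F `^ a * m x y `^ (a - 2))
                        (F `^ (a + b) * m x y `^ (a + b - 2)).
have mmp p : measurable_fun setT (fun y => m x y `^ p).
  exact: (measurableT_comp (measurable_powR p) (mm1 x)).
apply: (@integral_geometric_cover _ _ _ mu f g (6 * c * F) q) => //.
- by rewrite mulr_ge0 ?mulr_ge0// ltW.
- by apply: measurable_minr; apply: measurable_funM.
- by move=> y; rewrite le_min !mulr_ge0 ?powR_ge0.
- move=> j; apply: measurable_funD; apply: measurable_funM => //;
    exact: measurable_indic.
- by move=> j y; rewrite addr_ge0// !mulr_ge0 ?powR_ge0 ?exprn_ge0.
- move=> y; rewrite /f; have [m0|mn0] := eqVneq (m x y) 0.
    exists 0%N; rewrite m0 (powR0 (ltr0_neq0 am2)) (powR0 (ltr0_neq0 abm2)) !mulr0 minxx.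
    by rewrite addr_ge0// !mulr_ge0 ?powR_ge0 ?exprn_ge0.
  have mp : 0 < m x y by rewrite lt_neqAle eq_sym mn0/=.
  have X0 : 0 < F * m x y by rewrite mulr_gt0.
  have [X1|/ltW X1] := leP 1 (F * m x y).
    have [j /andP[jX Xj]] := dyadic_bracket _ X1; exists j.
    rewrite ge_min powFm//; apply/orP; left.
    rewrite /g ind1 ?mulr1; last by rewrite ltr_pdivlMr// mulrC.
    rewrite ler_wpDr ?mulr_ge0 ?powR_ge0 ?exprn_ge0//.
    by rewrite ler_wpM2l ?exprn_ge0// ler_powR2l_neg ?exprn_gt0// ltW.
  have [j /andP[jX Xj]] : exists j : nat, 2 ^+ j <= (F * m x y)^-1 < 2 ^+ j.+1.
    by apply: dyadic_bracket; rewrite invf_ge1.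
  have Xj' : (2 ^+ j.+1)^-1 <= F * m x y.
    by rewrite -[leRHS]invrK lef_pV2 ?posrE ?exprn_gt0 ?invr_gt0// ltW.
  have jX' : F * m x y < 2 / 2 ^+ j.
    rewrite (@le_lt_trans _ _ (2 ^+ j)^-1)//.
      by rewrite -[leLHS]invrK lef_pV2 ?posrE ?exprn_gt0 ?invr_gt0.
    by rewrite ltr_pMl ?invr_gt0 ?exprn_gt0// ltr1n.
  exists j; rewrite ge_min orbC powFm//; apply/orP; left.
  rewrite /g [X in _ + _ * X]ind1 ?mulr1; last by rewrite ltr_pdivlMr// mulrC.
  rewrite ler_wpDl ?mulr_ge0 ?powR_ge0 ?exprn_ge0//.
  rewrite ler_wpM2l ?exprn_ge0// ler_powR2l_neg ?invr_gt0 ?exprn_gt0//.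
  exact: ltW.
move=> j; under eq_integral do rewrite EFinD.
rewrite ge0_integralD//=; last 4 first.
- by move=> y _; rewrite lee_fin !mulr_ge0 ?powR_ge0 ?exprn_ge0.
- by apply/measurable_EFinP; apply: measurable_funM => //; exact: measurable_indic.
- by move=> y _; rewrite lee_fin !mulr_ge0 ?powR_ge0 ?exprn_ge0.
- by apply/measurable_EFinP; apply: measurable_funM => //; exact: measurable_indic.
apply: (le_trans (leeD (integral_mball _ _ _ _ _) (integral_mball _ _ _ _ _))).
1-4: by rewrite ?divr_gt0 ?invr_gt0 ?exprn_gt0 ?mulr_ge0 ?powR_ge0 ?exprn_ge0.
rewrite -EFinD lee_fin.
have e1 : (2 : R) `^ (a - 2) * 2 = 2 `^ (a - 1).
  by rewrite -{3}(powRr1 (ler0n R 2)) -powRDpos//; congr (_ `^ _); ring.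
have e2 : (2^-1 : R) `^ (a + b - 2) = 2 `^ (2 - a - b).
  by rewrite -powR_inv1// -powRrM; congr (_ `^ _); ring.
have e3 : (2 : R) `^ (2 - a - b) / 2 = 2 `^ (1 - a - b).
  by rewrite -[X in _ / X](powRr1 (ler0n R 2)) -powRN -powRDpos//;
     congr (_ `^ _); ring.
have e4 : (2 : R) `^ (2 - a - b) <= 2.
  by rewrite -[leRHS](powRr1 (ler0n R 2)) ler_powR ?ler1n//; lra.
rewrite powR_exprn// -exprVn powR_exprn ?invr_ge0// e2 !(exprS _ j) -exprVn.
have -> : F ^+ 2 * 2 `^ (a - 2) ^+ j * (c * (2 * 2 ^+ j / F)) +
    F ^+ 2 * (2 `^ (2 - a - b) * 2 `^ (2 - a - b) ^+ j) *
      (c * (2 * 2^-1 ^+ j / F)) =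
    c * F * (2 * 2 `^ (a - 1) ^+ j
      + 2 * 2 `^ (2 - a - b) * 2 `^ (1 - a - b) ^+ j).
  by rewrite -e1 -e3 !exprMn; field.
have q1 : 2 `^ (a - 1) ^+ j <= q ^+ j.
  by rewrite lerXn2r ?nnegrE ?powR_ge0// ?le_max ?powR_ge0// lexx.
have q2 : 2 `^ (1 - a - b) ^+ j <= q ^+ j.
  by rewrite lerXn2r ?nnegrE ?powR_ge0// ?le_max ?powR_ge0// lexx orbT.
have -> : 6 * c * F * q ^+ j = c * F * (6 * q ^+ j) by ring.
rewrite ler_wpM2l ?mulr_ge0 ?(ltW c0)//.
have q20 : 0 <= 2 `^ (1 - a - b) ^+ j :> R by rewrite exprn_ge0 ?powR_ge0.
have := ler_pM (powR_ge0 _ _) q20 e4 q2.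
lra.
Qed.

End kernel_mass.

(** * The Hardy-Littlewood-Sobolev inequality *)

Section hardy_littlewood_sobolev.
Variables a b : R.

Definition HLS_const : R := 1 + kernel_mass_const a b + kernel_mass_const b a.

Let measurable_pow (f : T * T -> R) p :
  measurable_fun setT f -> measurable_fun setT (fun z => f z `^ p).
Proof. exact: measurable_fun_powR. Qed.

Let measurable_fst1 (F : T -> R) : measurable_fun setT F ->
  measurable_fun setT (fun z : T * T => F z.1).
Proof. by move=> mF; exact: (measurableT_comp mF measurable_fst). Qed.

Let measurable_snd2 (F : T -> R) : measurable_fun setT F ->
  measurable_fun setT (fun z : T * T => F z.2).
Proof. by move=> mF; exact: (measurableT_comp mF measurable_snd). Qed.

Let kernel_term_measurable (F : T -> R) e f : measurable_fun setT F ->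
  measurable_fun setT (fun z : T * T => Num.min
   (F z.1 `^ e * m z.1 z.2 `^ (e - 2)) (F z.1 `^ f * m z.1 z.2 `^ (f - 2))).
Proof.
move=> mF; have mF1 p : measurable_fun setT (fun z : T * T => F z.1 `^ p).
  by apply: measurable_pow; exact: measurable_fst1.
by apply: measurable_minr; apply: measurable_funM => //; exact: measurable_powm.
Qed.

(** By Tonelli, integrate the second variable first: [kernel_mass] leaves a multiple of [F x]. *)
Let kernel_term_bound e f (F : T -> R) A : 0 < e < 1 -> 0 < f < 1 -> 1 < e + f ->
  0 <= kernel_mass_const e f ->
  measurable_fun setT F -> (forall x, 0 <= F x) ->
  (\int[mu]_x (F x)%:E <= A%:E)%E ->
  (\int[mu \x mu]_z (Num.min (F z.1 `^ e * m z.1 z.2 `^ (e - 2))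
     (F z.1 `^ (e + f) * m z.1 z.2 `^ (e + f - 2)))%:E
   <= (kernel_mass_const e f * A)%:E)%E.
Proof.
move=> e01 f01 ef1 K0 mF F0 FA.
pose k (z : T * T) : R := Num.min (F z.1 `^ e * m z.1 z.2 `^ (e - 2))
     (F z.1 `^ (e + f) * m z.1 z.2 `^ (e + f - 2)).
have mk : measurable_fun setT (EFin \o k).
  by apply/measurable_EFinP; exact: kernel_term_measurable.
have k0 z : (0 <= (EFin \o k) z)%E by rewrite lee_fin le_min !mulr_ge0 ?powR_ge0.
rewrite (fubini_tonelli1 (EFin \o k))//=.
apply: (@le_trans _ _ (\int[mu]_x ((kernel_mass_const e f)%:E * (F x)%:E))%E).
  apply: ge0_le_integral => //.
  - by move=> x _; apply: integral_ge0.
  - exact: (measurable_fun_fubini_tonelli_F (EFin \o k)).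
  - by apply/measurable_EFinP/measurable_funM.
  - by move=> x _; rewrite -EFinM; apply: (@kernel_mass e f x (F x)).
rewrite ge0_integralZl_EFin//; last 2 first.
- by move=> x _; rewrite lee_fin.
- exact/measurable_EFinP.
by rewrite [leRHS]EFinM lee_wpmul2l.
Qed.

(** Integrate [powR_kernel_le]. The product term gives [(int F) (int G) <= 1], and each minimum
    gives one kernel mass: these are the three summands of [HLS_const]. *)
Lemma HLS_normalized (F G : T -> R) :
  0 < a < 1 -> 0 < b < 1 -> 1 < a + b ->
  measurable_fun setT F -> measurable_fun setT G ->
  (forall x, 0 <= F x) -> (forall x, 0 <= G x) ->
  (\int[mu]_x (F x)%:E <= 1)%E -> (\int[mu]_x (G x)%:E <= 1)%E ->
  (\int[mu \x mu]_z (F z.1 `^ a * G z.2 `^ b * m z.1 z.2 `^ (a + b - 2))%:E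
   <= HLS_const%:E)%E.
Proof.
move=> a01 b01 ab1 mF mG F0 G0 F1 G1.
have ba1 : 1 < b + a by rewrite addrC.
pose h1 (z : T * T) : R := F z.1 * G z.2.
pose h2 (z : T * T) : R := Num.min (F z.1 `^ a * m z.1 z.2 `^ (a - 2))
     (F z.1 `^ (a + b) * m z.1 z.2 `^ (a + b - 2)).
pose h3 (z : T * T) : R := Num.min (G z.2 `^ b * m z.1 z.2 `^ (b - 2))
     (G z.2 `^ (b + a) * m z.1 z.2 `^ (b + a - 2)).
pose h3' (z : T * T) : R := Num.min (G z.1 `^ b * m z.1 z.2 `^ (b - 2))
     (G z.1 `^ (b + a) * m z.1 z.2 `^ (b + a - 2)).
have mF1 : measurable_fun setT (fun z : T * T => F z.1).
  exact: measurable_fst1.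
have mG2 : measurable_fun setT (fun z : T * T => G z.2).
  exact: measurable_snd2.
have mh1 : measurable_fun setT h1 by exact: measurable_funM.
have mh2 : measurable_fun setT h2 by exact: kernel_term_measurable.
have mh3' : measurable_fun setT h3' by exact: kernel_term_measurable.
have mh3 : measurable_fun setT h3.
  by apply: measurable_minr; apply: measurable_funM;
    [exact: measurable_pow|exact: measurable_powm
    |exact: measurable_pow|exact: measurable_powm].
have mEh1 : measurable_fun setT (EFin \o h1) by exact/measurable_EFinP.
have mEh2 : measurable_fun setT (EFin \o h2) by exact/measurable_EFinP.
have mEh3 : measurable_fun setT (EFin \o h3) by exact/measurable_EFinP.
have mEh3' : measurable_fun setT (EFin \o h3') by exact/measurable_EFinP.
have h10 z : 0 <= h1 z by rewrite mulr_ge0.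
have h20 z : 0 <= h2 z by rewrite le_min !mulr_ge0 ?powR_ge0.
have h30 z : 0 <= h3 z by rewrite le_min !mulr_ge0 ?powR_ge0.
have h30' z : 0 <= h3' z by rewrite le_min !mulr_ge0 ?powR_ge0.
apply: (@le_trans _ _ (\int[mu \x mu]_z ((h1 z)%:E + (h2 z)%:E + (h3 z)%:E))%E).
  apply: ge0_le_integral => //.
  - by move=> z _; rewrite lee_fin !mulr_ge0 ?powR_ge0.
  - apply/measurable_EFinP; apply: measurable_funM; last exact: measurable_powm.
    by apply: measurable_funM; exact: measurable_pow.
  - by apply/measurable_EFinP; apply: measurable_funD => //; exact: measurable_funD.
  - by move=> z _; rewrite -!EFinD lee_fin powR_kernel_le.
rewrite ge0_integralD//; last 3 first.
- by move=> z _; rewrite -EFinD lee_fin addr_ge0.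
- by apply/measurable_EFinP; exact: measurable_funD.
- by move=> z _; rewrite lee_fin.
rewrite ge0_integralD//; last 2 first.
- by move=> z _; rewrite lee_fin.
- by move=> z _; rewrite lee_fin.
rewrite /HLS_const !EFinD leeD ?leeD//.
- rewrite (fubini_tonelli1 (EFin \o h1))//.
  rewrite /fubini_F (eq_integral (fun x => (F x)%:E * \int[mu]_y (G y)%:E)%E).
    2: move=> x _; rewrite -ge0_integralZl_EFin//.
    2: by move=> y _; rewrite lee_fin.
    2: exact/measurable_EFinP.
  rewrite ge0_integralZr//; last 3 first.
  + exact/measurable_EFinP.
  + by move=> x _; rewrite lee_fin.
  + by apply: integral_ge0 => x _; rewrite lee_fin.
  rewrite -[leRHS]mule1 lee_pmul//; by apply: integral_ge0 => x _; rewrite lee_fin.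
- by rewrite -[kernel_mass_const a b]mulr1 kernel_term_bound// kernel_mass_const_ge0.
(* The third term carries [G] in the second variable. Tonelli in the other order and the symmetry of
   [m] bring it to the form of [kernel_term_bound]. *)
- have -> : (\int[mu \x mu]_z (h3 z)%:E = \int[mu \x mu]_z (h3' z)%:E)%E.
    transitivity (\int[mu]_y fubini_G mu (EFin \o h3) y)%E.
      exact: (fubini_tonelli2 (EFin \o h3)).
    transitivity (\int[mu]_y fubini_F mu (EFin \o h3') y)%E; last first.
      by apply/esym; exact: (fubini_tonelli1 (EFin \o h3')).
    apply: eq_integral => y _; apply: eq_integral => x _.
    by rewrite /h3 /h3' /= mC.
  by rewrite -[kernel_mass_const b a]mulr1 kernel_term_bound// kernel_mass_const_ge0.
Qed.

Lemma HLS_const_gt0 : 0 < a < 1 -> 0 < b < 1 -> 1 < a + b -> 0 < HLS_const.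
Proof.
move=> a01 b01 ab1; have ba1 : 1 < b + a by rewrite addrC.
by rewrite /HLS_const -addrA ltr_pwDl// addr_ge0// kernel_mass_const_ge0.
Qed.

(** Apply the normalized case to [F / A] and [G / B]: the integrand is homogeneous of degree [a] in
    [F] and [b] in [G]. *)
Lemma HLS (F G : T -> R) (A B : R) :
  0 < a < 1 -> 0 < b < 1 -> 1 < a + b ->
  measurable_fun setT F -> measurable_fun setT G ->
  (forall x, 0 <= F x) -> (forall x, 0 <= G x) -> 0 < A -> 0 < B ->
  (\int[mu]_x (F x)%:E <= A%:E)%E -> (\int[mu]_x (G x)%:E <= B%:E)%E ->
  (\int[mu \x mu]_z (F z.1 `^ a * G z.2 `^ b * m z.1 z.2 `^ (a + b - 2))%:E
   <= (HLS_const * (A `^ a * B `^ b))%:E)%E.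
Proof.
move=> a01 b01 ab1 mF mG F0 G0 A0 B0 FA GB.
have normalize (H : T -> R) (C : R) : measurable_fun setT H ->
    (forall x, 0 <= H x) -> 0 < C -> (\int[mu]_x (H x)%:E <= C%:E)%E ->
    (\int[mu]_x (C^-1 * H x)%:E <= 1)%E.
  move=> mH H0 C0 HC; under eq_integral do rewrite EFinM.
  rewrite ge0_integralZl_EFin ?invr_ge0 ?(ltW C0)//; last 2 first.
  - by move=> x _; rewrite lee_fin.
  - exact/measurable_EFinP.
  by rewrite lee_pdivrMl// mule1.
pose F' x := A^-1 * F x; pose G' x := B^-1 * G x.
have mF' : measurable_fun setT F' by exact: measurable_funM.
have mG' : measurable_fun setT G' by exact: measurable_funM.
have F'0 x : 0 <= F' x by rewrite mulr_ge0// invr_ge0 ltW.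
have G'0 x : 0 <= G' x by rewrite mulr_ge0// invr_ge0 ltW.
have := HLS_normalized F' G' a01 b01 ab1 mF' mG' F'0 G'0
  (normalize _ _ mF F0 A0 FA) (normalize _ _ mG G0 B0 GB).
have AB0 : 0 < A `^ a * B `^ b by rewrite mulr_gt0 ?powR_gt0.
rewrite mulrC EFinM => /(lee_wpmul2l _) h.
apply: le_trans (h _ _); last by rewrite lee_fin ltW.
rewrite -ge0_integralZl_EFin ?(ltW AB0)//; last 2 first.
- by move=> z _; rewrite lee_fin !mulr_ge0 ?powR_ge0.
- apply/measurable_EFinP; apply: measurable_funM; last exact: measurable_powm.
  by apply: measurable_funM; apply: measurable_pow;
    [exact: measurable_fst1|exact: measurable_snd2].
rewrite le_eqVlt; apply/orP; left; apply/eqP; apply: eq_integral => z _.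
rewrite -EFinM; congr EFin.
rewrite /F' /G' !powRM ?invr_ge0 ?(ltW A0) ?(ltW B0)// -!powR_inv1 ?(ltW A0) ?(ltW B0)//.
rewrite -!powRrM !mulN1r !powRN; field.
by rewrite !gt_eqF ?powR_gt0.
Qed.

End hardy_littlewood_sobolev.

(** These two exponents occur when the kernel [m ^ (a - 1)] is tested on [L^p] by duality; their sum
    is [1 + a]. *)
Lemma HLS_const_conj_gt0 a p : 0 < a -> 1 < p -> a + p^-1 < 1 ->
  0 < HLS_const (1 - p^-1) (a + p^-1).
Proof.
move=> a0 p1 ap1; have pV0 : 0 < p^-1 by rewrite invr_gt0 (lt_trans ltr01 p1).
apply: HLS_const_gt0.
- by rewrite subr_gt0 invf_lt1 ?(lt_trans ltr01 p1)// p1 ltrBlDr ltrDl.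
- by rewrite ap1 addr_gt0.
- by rewrite addrCA subrK ltrDr.
Qed.

(** * Potentials: pairing, finiteness almost everywhere and [L^p] bounds *)

Definition potential (u : T -> R) (e : R) (x : T) : \bar R :=
  (\int[mu]_y (u y * m x y `^ e)%:E)%E.

Section potential_bounds.
Variables (u : T -> R).
Hypothesis umeas : measurable_fun setT u.
Hypothesis u0 : forall y, 0 <= u y.

Lemma potential_ge0 e x : (0 <= potential u e x)%E.
Proof. by apply: integral_ge0 => y _; rewrite lee_fin mulr_ge0 ?powR_ge0. Qed.

Let measurable_potential_kernel e :
  measurable_fun setT (EFin \o (fun z : T * T => u z.2 * m z.1 z.2 `^ e)).
Proof.
apply/measurable_EFinP; apply: measurable_funM; last exact: measurable_powm.
exact: (measurableT_comp umeas measurable_snd).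
Qed.

Lemma measurable_potential e : measurable_fun setT (potential u e).
Proof.
apply: (measurable_fun_fubini_tonelli_F
  (EFin \o (fun z : T * T => u z.2 * m z.1 z.2 `^ e))).
  exact: measurable_potential_kernel.
by move=> z; rewrite lee_fin mulr_ge0 ?powR_ge0.
Qed.

(** This is [HLS] for [g ^ (1/b)] and [u ^ (1/a)], with the double integral unfolded by Tonelli. *)
Lemma potential_pairing (g : T -> R) a b A B :
  0 < a < 1 -> 0 < b < 1 -> 1 < a + b -> 0 < A -> 0 < B ->
  measurable_fun setT g -> (forall x, 0 <= g x) ->
  (\int[mu]_y (u y `^ a^-1)%:E <= A%:E)%E ->
  (\int[mu]_x (g x `^ b^-1)%:E <= B%:E)%E ->
  (\int[mu]_x ((g x)%:E * potential u (a + b - 2) x)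
   <= (HLS_const b a * (B `^ b * A `^ a))%:E)%E.
Proof.
move=> a01 b01 ab1 A0 B0 mg g0 uA gB.
have ba1 : 1 < b + a by rewrite addrC.
have [a0 _] := andP a01; have [b0 _] := andP b01.
have mub : measurable_fun setT (fun y => u y `^ a^-1) by exact: measurable_fun_powR.
have mgb : measurable_fun setT (fun y => g y `^ b^-1) by exact: measurable_fun_powR.
have h := HLS _ _ _ _ _ _ b01 a01 ba1 mgb mub (fun=> powR_ge0 _ _)
  (fun=> powR_ge0 _ _) B0 A0 gB uA.
apply: le_trans h.
pose k (z : T * T) : R := g z.1 * (u z.2 * m z.1 z.2 `^ (a + b - 2)).
have mk : measurable_fun setT (EFin \o k).
  apply/measurable_EFinP; apply: measurable_funM.
    exact: (measurableT_comp mg measurable_fst).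
  apply: measurable_funM; last exact: measurable_powm.
  exact: (measurableT_comp umeas measurable_snd).
have k0 z : (0 <= (EFin \o k) z)%E by rewrite lee_fin !mulr_ge0 ?powR_ge0.
rewrite [leRHS](_ : _ = \int[mu \x mu]_z (EFin \o k) z)%E; last first.
  apply: eq_integral => z _ /=; congr EFin.
  by rewrite /k -!powRrM !mulVf ?gt_eqF// !powRr1// [b + a]addrC -mulrA.
rewrite (fubini_tonelli1 (EFin \o k))// le_eqVlt; apply/orP; left; apply/eqP.
apply: eq_integral => x _.
rewrite /potential /fubini_F -ge0_integralZl_EFin//.
- by move=> y _; rewrite lee_fin mulr_ge0 ?powR_ge0.
- exact: (measurableT_comp (measurable_potential_kernel _) (measurable_pair1 x)).
Qed.

(** Pairing with the indicator of [D] shows that the potential is integrable on [D]. The bound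
    [mu D + 1] stays positive even for a null [D]. *)
Lemma potential_ae_fin_num (D : set T) a b A :
  0 < a < 1 -> 0 < b < 1 -> 1 < a + b -> 0 < A ->
  (\int[mu]_y (u y `^ a^-1)%:E <= A%:E)%E ->
  measurable D -> (mu D < +oo)%E ->
  {ae mu, forall x, D x -> potential u (a + b - 2) x \is a fin_num}.
Proof.
move=> a01 b01 ab1 A0 uA mD Doo.
have mp := measurable_potential (a + b - 2).
have [b0 _] := andP b01.
apply: integrable_ae => //; apply/integrableP; split.
  exact: measurable_funS mp.
under eq_integral do rewrite gee0_abs ?potential_ge0//.
have m1D : measurable_fun setT (\1_D : T -> R) by exact: measurable_indic.
have muD : (mu D <= (fine (mu D) + 1)%:E)%E.
  by rewrite EFinD fineK ?ge0_fin_numE// leeDl.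
have B0 : 0 < fine (mu D) + 1 by rewrite ltr_wpDl// fine_ge0.
have h := potential_pairing (\1_D : T -> R) _ _ _ _ a01 b01 ab1 A0 B0 m1D _ uA _.
apply: (@le_lt_trans _ _ _ _ _ _ (ltry _)); last first.
  rewrite integral_mkcond; apply: le_trans (h _ _).
  - rewrite le_eqVlt; apply/orP; left; apply/eqP; apply: eq_integral => x _.
    by rewrite patchE indicE; case: ifPn => _; rewrite ?mul1e ?mul0e.
  - by move=> x; rewrite indicE.
  - rewrite (eq_integral (fun x => (\1_D x)%:E)).
      by rewrite integral_indic// setIT.
    move=> x _; rewrite indicE; case: (x \in D); rewrite ?powR1//.
    by rewrite powR0// invr_eq0 gt_eqF.
Qed.

(** Duality: pair with [j ^ (p - 1)], whose conjugate power is [j ^ p]. The integral [B] of [j ^ p]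
    then satisfies [B <= K * B ^ (1 - 1/p)], and dividing gives [B <= K ^ p]. The division requires
    [B] finite, hence the truncation of [j]. *)
Lemma potential_Lp (D : set T) (j : T -> R) a p A :
  let K := HLS_const (1 - p^-1) a * A `^ a in
  0 < a < 1 -> 1 < p -> p^-1 < a -> 0 < A ->
  (\int[mu]_y (u y `^ a^-1)%:E <= A%:E)%E ->
  measurable D -> (mu D < +oo)%E ->
  measurable_fun setT j -> (forall x, 0 <= j x) -> (forall x, ~ D x -> j x = 0) ->
  (forall x, ((j x)%:E <= potential u (a - p^-1 - 1) x)%E) ->
  (\int[mu]_x (j x `^ p)%:E <= (K `^ p)%:E)%E.
Proof.
move=> K a01 p1 pa A0 uA mD Doo mj j0 jD jle.
have p0 : 0 < p by exact: lt_trans ltr01 p1.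
have b01 : 0 < 1 - p^-1 < 1.
  by rewrite subr_gt0 invf_lt1// p1 ltrBlDr ltrDl invr_gt0.
have [b0 b1] := andP b01.
have K0 : 0 <= K.
  by rewrite mulr_ge0 ?powR_ge0// ltW// HLS_const_gt0//; move: pa; lra.
apply: integral_powR_trunc_le => // k.
pose jk x : R := Num.min (j x) k%:R; rewrite -/(jk _).
have mjk : measurable_fun setT jk by exact: measurable_minr.
have jk0 x : 0 <= jk x by rewrite le_min j0 ler0n.
have mjkp e : measurable_fun setT (fun x => jk x `^ e) by exact: measurable_fun_powR.
(* The truncation is bounded by [k] and vanishes off [D], which has finite measure. *)
have fin : (\int[mu]_x (jk x `^ p)%:E)%E \is a fin_num.
  rewrite ge0_fin_numE; last by apply: integral_ge0 => x _; rewrite lee_fin powR_ge0.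
  apply: (@le_lt_trans _ _ (\int[mu]_x ((k%:R `^ p)%:E * (\1_D x)%:E))%E).
    apply: ge0_le_integral => //.
    - by move=> x _; rewrite lee_fin powR_ge0.
    - exact/measurable_EFinP.
    - by apply/measurable_EFinP; apply: measurable_funM => //; exact: measurable_indic.
    move=> x _; rewrite -EFinM lee_fin indicE; have [xD|xD] := boolP (x \in D).
      by rewrite mulr1 ler_powR2l ?(ltW p0)// ge_min lexx orbT.
    have jx0 : j x = 0 by apply: jD; move: xD; rewrite notin_setE.
    by rewrite mulr0 /jk jx0 (min_idPl _) ?powR0 ?gt_eqF.
  rewrite ge0_integralZl_EFin ?powR_ge0//; last first.
    by apply/measurable_EFinP; exact: measurable_indic.
  by rewrite integral_indic// setIT lte_mul_pinfty// lee_fin powR_ge0.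
rewrite -(fineK fin) lee_fin; set B := fine _.
have [B0|Bp] := leP B 0; first by rewrite (le_trans B0) ?powR_ge0.
have gB : (\int[mu]_x ((jk x `^ (p - 1)) `^ (1 - p^-1)^-1)%:E <= B%:E)%E.
  rewrite /B fineK// le_eqVlt; apply/orP; left; apply/eqP.
  apply: eq_integral => x _; congr EFin; rewrite -powRrM; congr (_ `^ _).
  by field; rewrite gt_eqF// subr_eq0 gt_eqF.
have ab1 : 1 < a + (1 - p^-1) by move: pa; lra.
have := potential_pairing _ _ _ _ _ a01 b01 ab1 A0 Bp (mjkp (p - 1))
  (fun=> powR_ge0 _ _) uA gB.
have -> : a + (1 - p^-1) - 2 = a - p^-1 - 1 by ring.
have BJ : (B%:E <= \int[mu]_x ((jk x `^ (p - 1))%:E * potential u (a - p^-1 - 1) x))%E.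
  rewrite /B fineK//; apply: ge0_le_integral => //.
  - by move=> x _; rewrite lee_fin powR_ge0.
  - exact/measurable_EFinP.
  - by apply: emeasurable_funM; [exact/measurable_EFinP|exact: measurable_potential].
  move=> x _; rewrite -mulr_powRB1// mulrC EFinM.
  apply: lee_wpmul2l; first by rewrite lee_fin powR_ge0.
  by apply: le_trans (jle x); rewrite lee_fin ge_min lexx.
move=> /(le_trans BJ); rewrite lee_fin mulrCA -/K => BK.
have {BK} : B `^ p^-1 <= K.
  rewrite -(@ler_pM2l _ (B `^ (1 - p^-1))) ?powR_gt0//.
  by rewrite -powRDpos// subrK powRr1 ?(ltW Bp).
move=> /(ler_powR2l _ _ _ (ltW p0) (powR_ge0 _ _)).
by rewrite -powRrM mulVf ?gt_eqF// powRr1// ltW.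
Qed.

End potential_bounds.

(** * Regularity lifting from [L^r] to [L^nu] *)

Section regularity_lifting.
Variables (D : set T) (V : T -> R) (a A kappa : R).
Hypothesis mD : measurable D.
Hypothesis Doo : (mu D < +oo)%E.
Hypothesis mV : measurable_fun setT V.
Hypothesis V0 : forall x, 0 <= V x.
Hypothesis a_gt0 : 0 < a.
Hypothesis A_gt0 : 0 < A.
Hypothesis VA : (\int[mu]_x (V x `^ a^-1)%:E <= A%:E)%E.
Hypothesis kappa_ge0 : 0 <= kappa.

Let mVw (w : T -> R) : measurable_fun setT w -> measurable_fun setT (fun x => V x * w x).
Proof. exact: measurable_funM. Qed.

Let Vw_ge0 (w : T -> R) : (forall x, 0 <= w x) -> forall x, 0 <= V x * w x.
Proof. by move=> w0 x; rewrite mulr_ge0. Qed.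

(** Hoelder for [V ^ (1/a)] and [w ^ q], with weights [a] and [1/q] divided by their sum. *)
Let Vw_integral (w : T -> R) (q B : R) : 0 < q -> 0 < B ->
  measurable_fun setT w -> (forall x, 0 <= w x) ->
  (\int[mu]_x (w x `^ q)%:E <= B%:E)%E ->
  (\int[mu]_x ((V x * w x) `^ (a + q^-1)^-1)%:E
   <= ((A `^ a * B `^ q^-1) `^ (a + q^-1)^-1)%:E)%E.
Proof.
move=> q0 B0 mw w0 wB.
have qV0 : 0 < q^-1 by rewrite invr_gt0.
have aq0 : 0 < a + q^-1 by rewrite addr_gt0.
have := @integral_powR_hoelder _ _ _ mu (fun x => V x `^ a^-1) (fun x => w x `^ q)
  (a / (a + q^-1)) (q^-1 / (a + q^-1)) A B (divr_gt0 a_gt0 aq0)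
  (divr_gt0 qV0 aq0) _ A_gt0 B0 (measurable_fun_powR _ _ _ _ _ _ mV)
  (measurable_fun_powR _ _ _ _ _ _ mw) (fun=> powR_ge0 _ _) (fun=> powR_ge0 _ _)
  VA wB.
rewrite -mulrDl mulfV ?gt_eqF// => /(_ erefl).
under eq_integral do rewrite -!powRrM !mulrA mulVf ?gt_eqF// mulfV ?gt_eqF//
  mul1r -powRM//.
by rewrite powRM ?powR_ge0// -!powRrM.
Qed.

(** Hoelder puts [V w] in [L^(1/(a + 1/q))], and [potential_Lp] takes it from there to [L^p]. For
    [p = q] the kernel is [m ^ (a - 1)]; for [p > q] it is less singular, and integrability is
    gained. *)
Lemma potential_mul_Lp (w j : T -> R) (p q B : R) : 0 < q -> 1 < p ->
  a + q^-1 < 1 -> p^-1 < a + q^-1 -> 0 < B ->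
  measurable_fun setT w -> (forall x, 0 <= w x) ->
  (\int[mu]_x (w x `^ q)%:E <= B%:E)%E ->
  measurable_fun setT j -> (forall x, 0 <= j x) -> (forall x, ~ D x -> j x = 0) ->
  (forall x, ((j x)%:E <=
     potential (fun y => V y * w y)%R (a + q^-1 - p^-1 - 1)%R x)%E) ->
  (\int[mu]_x (j x `^ p)%:E <=
   ((HLS_const (1 - p^-1) (a + q^-1) * (A `^ a * B `^ q^-1)) `^ p)%:E)%E.
Proof.
move=> q0 p1 aq1 paq B0 mw w0 wB mj j0 jD jle.
have qV0 : 0 < q^-1 by rewrite invr_gt0.
have aq0 : 0 < a + q^-1 by rewrite addr_gt0.
have AB0 : 0 < (A `^ a * B `^ q^-1) `^ (a + q^-1)^-1.
  by rewrite powR_gt0 ?mulr_gt0 ?powR_gt0.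
have aq01 : 0 < a + q^-1 < 1 by rewrite aq0.
have := potential_Lp _ (mVw _ mw) (Vw_ge0 _ w0) _ _ _ _ _ aq01 p1 paq AB0
  (Vw_integral _ _ _ q0 B0 mw w0 wB) mD Doo mj j0 jD jle.
by rewrite -powRrM mulVf ?gt_eqF// powRr1// mulr_ge0 ?powR_ge0.
Qed.

Lemma potential_mul_ae_fin_num (w : T -> R) (p q B : R) : 0 < q -> 1 < p ->
  a + q^-1 < 1 -> p^-1 < a + q^-1 -> 0 < B ->
  measurable_fun setT w -> (forall x, 0 <= w x) ->
  (\int[mu]_x (w x `^ q)%:E <= B%:E)%E ->
  {ae mu, forall x, D x ->
    potential (fun y => V y * w y)%R (a + q^-1 - p^-1 - 1)%R x \is a fin_num}.
Proof.
move=> q0 p1 aq1 paq B0 mw w0 wB.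
have p0 : 0 < p by exact: lt_trans ltr01 p1.
have qV0 : 0 < q^-1 by rewrite invr_gt0.
have aq0 : 0 < a + q^-1 by rewrite addr_gt0.
have -> : a + q^-1 - p^-1 - 1 = a + q^-1 + (1 - p^-1) - 2 by ring.
apply: (potential_ae_fin_num _ (mVw _ mw) (Vw_ge0 _ w0) D _ _
  ((A `^ a * B `^ q^-1) `^ (a + q^-1)^-1)) => //.
- by rewrite aq0.
- by rewrite subr_gt0 invf_lt1// p1 ltrBlDr ltrDl invr_gt0.
- by move: paq; lra.
- by rewrite powR_gt0 ?mulr_gt0 ?powR_gt0.
- exact: Vw_integral.
Qed.

(** The operator [S] of the idea. [fine] turns an infinite potential into 0, which [op_ae_fin_num]
    confines to a null subset of [D]. *)
Let op (w : T -> R) (x : T) : R :=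
  kappa * (fine (potential (fun y => V y * w y)%R (a - 1) x) * \1_D x).

Let op_ge0 (w : T -> R) x : (forall x, 0 <= w x) -> 0 <= op w x.
Proof.
by move=> w0; rewrite !mulr_ge0// fine_ge0// potential_ge0//; exact: Vw_ge0.
Qed.

Let measurable_op (w : T -> R) : measurable_fun setT w -> (forall x, 0 <= w x) ->
  measurable_fun setT (op w).
Proof.
move=> mw w0; apply: measurable_funM => //; apply: measurable_funM.
  apply: (measurableT_comp (fine_measurable _)) => //.
  by apply: measurable_potential; [exact: mVw|exact: Vw_ge0].
exact: measurable_indic.
Qed.

(** The case [p = q] of [potential_mul_Lp]: the factor in front of [B] is the operator bound raised
    to the power [q], to be made small through [A]. *)
Let op_Lp (w : T -> R) (q B : R) : 1 < q -> a + q^-1 < 1 -> 0 < B ->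
  measurable_fun setT w -> (forall x, 0 <= w x) ->
  (\int[mu]_x (w x `^ q)%:E <= B%:E)%E ->
  (\int[mu]_x (op w x `^ q)%:E <=
   ((kappa * HLS_const (1 - q^-1) (a + q^-1) * A `^ a) `^ q * B)%:E)%E.
Proof.
move=> q1 aq1 B0 mw w0 wB.
have q0 : 0 < q by exact: lt_trans ltr01 q1.
have qV0 : 0 < q^-1 by rewrite invr_gt0.
have ltq : q^-1 < a + q^-1 by rewrite ltrDr.
pose j x := fine (potential (fun y => V y * w y)%R (a - 1) x) * \1_D x.
have pot0 x : (0 <= potential (fun y => V y * w y)%R (a - 1)%R x)%E.
  by apply: potential_ge0; exact: Vw_ge0.
have j0 x : 0 <= j x by rewrite mulr_ge0// fine_ge0.
have mj : measurable_fun setT j.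
  apply: measurable_funM; last exact: measurable_indic.
  apply: (measurableT_comp (fine_measurable _)) => //.
  by apply: measurable_potential; [exact: mVw|exact: Vw_ge0].
have jD x : ~ D x -> j x = 0.
  by move=> xD; rewrite /j indicE memNset// mulr0.
have jle x : ((j x)%:E <=
    potential (fun y => V y * w y)%R (a + q^-1 - q^-1 - 1)%R x)%E.
  rewrite addrK /j indicE; case: (x \in D); rewrite ?mulr0// mulr1.
  by move: (pot0 x); case: (potential _ _ _) => [s|_|//] //=; exact: leey.
have := potential_mul_Lp _ _ _ _ _ q0 q1 aq1 ltq B0 mw w0 wB mj j0 jD jle.
move=> /(lee_wpmul2l (_ : 0 <= (kappa `^ q)%:E)%E).
rewrite -ge0_integralZl_EFin ?powR_ge0//; last 2 first.
- by move=> x _; rewrite lee_fin powR_ge0.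
- by apply/measurable_EFinP; exact: measurable_fun_powR.
rewrite lee_fin powR_ge0 => /(_ isT).
set C := HLS_const _ _.
have C0 : 0 <= C by rewrite ltW// HLS_const_conj_gt0.
have -> : (\int[mu]_x ((kappa `^ q)%:E * (j x `^ q)%:E) =
    \int[mu]_x (op w x `^ q)%:E)%E.
  by apply: eq_integral => x _; rewrite -EFinM -powRM.
move=> /le_trans; apply; rewrite -EFinM lee_fin.
rewrite !powRM ?mulr_ge0 ?powR_ge0// -[B `^ q^-1 `^ q]powRrM mulVf ?gt_eqF//.
by rewrite powRr1 ?(ltW B0)// !mulrA.
Qed.

Let op_ae_fin_num (w : T -> R) (q B : R) : 1 < q -> a + q^-1 < 1 -> 0 < B ->
  measurable_fun setT w -> (forall x, 0 <= w x) ->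
  (\int[mu]_x (w x `^ q)%:E <= B%:E)%E ->
  {ae mu, forall x, D x ->
    potential (fun y => V y * w y)%R (a - 1) x \is a fin_num}.
Proof.
move=> q1 aq1 B0 mw w0 wB.
have q0 : 0 < q by exact: lt_trans ltr01 q1.
have -> : a - 1 = a + q^-1 - q^-1 - 1 by rewrite addrK.
by apply: (potential_mul_ae_fin_num _ _ _ _ _ _ _ _ B0) => //; rewrite ltrDr.
Qed.

(** Each use of the inequality turns [W <= w1 + w2] into [W <= op w1 + (op w2 + H)], which halves
    the bound on the integral of [w1 ^ r] and preserves the one on the integral of [w2 ^ nu]. The
    final estimate is made for [min W K], with a bound independent of [K]. *)
Lemma regularity_lifting (W H : T -> R) (r nu : R) :
  1 < r -> r < nu -> a + r^-1 < 1 ->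
  (kappa * HLS_const (1 - r^-1) (a + r^-1) * A `^ a) `^ r <= 2^-1 ->
  2 `^ nu * (kappa * HLS_const (1 - nu^-1) (a + nu^-1) * A `^ a) `^ nu <= 2^-1 ->
  measurable_fun setT W -> (forall x, 0 <= W x) -> (forall x, ~ D x -> W x = 0) ->
  measurable_fun setT H -> (forall x, 0 <= H x) ->
  {ae mu, forall x, D x -> ((W x)%:E <=
     kappa%:E * potential (fun y => V y * W y)%R (a - 1)%R x + (H x)%:E)%E} ->
  (\int[mu]_x (W x `^ r)%:E < +oo)%E ->
  (\int[mu]_x (H x `^ nu)%:E < +oo)%E ->
  (\int[mu]_x (W x `^ nu)%:E < +oo)%E.
Proof.
move=> r1 rnu ar1 Sr Snu mW W0 WD mH H0 WH Wr Hnu.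
have nu1 : 1 < nu by exact: lt_trans r1 rnu.
have r0 : 0 < r by exact: lt_trans ltr01 r1.
have nu0 : 0 < nu by exact: lt_trans r0 rnu.
have anu1 : a + nu^-1 < 1.
  by apply: lt_trans ar1; rewrite ltrD2l ltf_pV2.
have mpow (f : T -> R) p : measurable_fun setT f ->
  measurable_fun setT (fun x => (f x `^ p)%:E).
  by move=> mf; apply/measurable_EFinP; exact: measurable_fun_powR.
have [M M0 WM] := integral_powR_lty _ _ _ _ _ _ Wr.
have [N N0 HN] := integral_powR_lty _ _ _ _ _ _ Hnu.
(* Chosen so that [B / 2 + 2^nu N = B]: the bound on [w2] then reproduces itself under
   [w2 |-> op w2 + H]. *)
pose B := 2 * 2 `^ nu * N.
have B0 : 0 < B by rewrite !mulr_gt0 ?powR_gt0.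
have decomposition k : exists w1 w2 : T -> R,
    [/\ measurable_fun setT w1, measurable_fun setT w2,
        (forall x, 0 <= w1 x) /\ (forall x, 0 <= w2 x),
        {ae mu, forall x, W x <= w1 x + w2 x} &
        (\int[mu]_x (w1 x `^ r)%:E <= (M / 2 ^+ k)%:E)%E /\
        (\int[mu]_x (w2 x `^ nu)%:E <= B%:E)%E].
  elim: k => [|k [w1 [w2 [mw1 mw2 [w10 w20] Ww [w1M w2B]]]]].
    exists W, (cst 0); split => //.
    - by apply: nearW => x; rewrite addr0.
    - split; first by rewrite expr0 divr1.
      under eq_integral do rewrite powR0 ?gt_eqF//.
      by rewrite integral0 lee_fin ltW.
  have Mk : 0 < M / 2 ^+ k by rewrite divr_gt0 ?exprn_gt0.
  exists (op w1), (fun x => op w2 x + H x); split.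
  - exact: measurable_op.
  - by apply: measurable_funD => //; exact: measurable_op.
  - by split=> x; rewrite ?addr_ge0// op_ge0.
  - have f1 := op_ae_fin_num _ _ _ r1 ar1 Mk mw1 w10 w1M.
    have f2 := op_ae_fin_num _ _ _ nu1 anu1 B0 mw2 w20 w2B.
    (* The bound [W <= w1 + w2] holds only almost everywhere, but after integration it holds at
       every [x]. *)
    have potW x : (potential (fun y => V y * W y)%R (a - 1)%R x <=
        potential (fun y => V y * w1 y)%R (a - 1)%R x +
        potential (fun y => V y * w2 y)%R (a - 1)%R x)%E.
      have mp : measurable_fun setT (fun y => m x y `^ (a - 1)).
        by apply: measurable_fun_powR; exact: mm1.
      have mVwp w : measurable_fun setT w ->
          measurable_fun setT (fun y => (V y * w y * m x y `^ (a - 1))%:E).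
        move=> mw; apply/measurable_EFinP; apply: measurable_funM => //.
        exact: mVw.
      have Vwp0 w y : (forall y, 0 <= w y) ->
          (0 <= (V y * w y * m x y `^ (a - 1))%:E)%E.
        by move=> w0; rewrite lee_fin !mulr_ge0 ?powR_ge0.
      rewrite /potential -ge0_integralD//; last 4 first.
      + by move=> y _; exact: Vwp0.
      + exact: mVwp.
      + by move=> y _; exact: Vwp0.
      + exact: mVwp.
      apply: ae_ge0_le_integral => //.
      + by move=> y _; exact: Vwp0.
      + exact: mVwp.
      + by move=> y _; rewrite adde_ge0// Vwp0.
      + by apply: emeasurable_funD; exact: mVwp.
      apply: filterS Ww => y Wy _.
      by rewrite -EFinD lee_fin -mulrDl -mulrDr ler_wpM2r ?powR_ge0// ler_wpM2l.
    apply: filterS3 f1 f2 WH => x f1 f2 WH.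
    have [xD|xD] := pselect (D x); last first.
      by rewrite WD// !addr_ge0// op_ge0.
    have := WH xD; move/le_trans => /(_ ((op w1 x + (op w2 x + H x))%:E)).
    rewrite lee_fin; apply.
    rewrite addrA EFinD leeD2r// /op indicE mem_set// !mulr1 -mulrDr EFinM.
    rewrite lee_wpmul2l ?lee_fin// (le_trans (potW x))//.
    by rewrite EFinD !fineK// ?f1 ?f2.
  - split.
      apply: le_trans (op_Lp _ _ _ r1 ar1 Mk mw1 w10 w1M) _.
      have -> : M / 2 ^+ k.+1 = 2^-1 * (M / 2 ^+ k) by rewrite exprS; field.
      by rewrite lee_fin ler_wpM2r// ltW.
    apply: (@le_trans _ _ (\int[mu]_x ((2 `^ nu)%:E *
        ((op w2 x `^ nu)%:E + (H x `^ nu)%:E)))%E).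
      apply: ge0_le_integral => //.
      + by move=> x _; rewrite lee_fin powR_ge0.
      + by apply: (mpow (fun x => op w2 x + H x)); apply: measurable_funD => //; exact: measurable_op.
      + apply: emeasurable_funM => //; apply: emeasurable_funD; apply: mpow => //.
        exact: measurable_op.
      by move=> x _; rewrite -EFinD -EFinM lee_fin powRD_le ?op_ge0// ltW.
    rewrite ge0_integralZl_EFin ?powR_ge0//; last 2 first.
    + by move=> x _; rewrite -EFinD lee_fin addr_ge0 ?powR_ge0.
    + by apply: emeasurable_funD; apply: mpow => //; exact: measurable_op.
    rewrite ge0_integralD//; last 4 first.
    + by move=> x _; rewrite lee_fin powR_ge0.
    + by apply: mpow; exact: measurable_op.
    + by move=> x _; rewrite lee_fin powR_ge0.
    + exact: mpow.
    have := leeD (op_Lp _ _ _ nu1 anu1 B0 mw2 w20 w2B) HN.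
    move=> /(lee_wpmul2l (_ : 0 <= (2 `^ nu)%:E)%E).
    rewrite lee_fin powR_ge0 => /(_ isT) /le_trans; apply.
    rewrite -EFinD -EFinM lee_fin mulrDr mulrA.
    apply: (@le_trans _ _ (2^-1 * B + 2 `^ nu * N)).
      by rewrite lerD2r ler_wpM2r// ltW.
    by rewrite le_eqVlt; apply/orP; left; apply/eqP; rewrite /B; field.
apply: (@le_lt_trans _ _ (2 `^ nu * (1 + B))%:E); last exact: ltry.
apply: integral_powR_trunc_le => // K.
(* For fixed [K], the part from [w1] contributes at most [L / 2^k]; [k] is taken so large that this
   is at most 1. *)
pose L : R := K%:R `^ (nu - r) * M.
have L0 : 0 <= L by rewrite mulr_ge0 ?powR_ge0// ltW.
have [k Lk] : exists k, L / 2 ^+ k <= 1.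
  exists (Num.truncn L).+1; rewrite ler_pdivrMr ?exprn_gt0// mul1r.
  rewrite (le_trans (ltW (truncnS_gt L)))// -natrX ler_nat ltnW// ltn_expl//.
have [w1 [w2 [mw1 mw2 [w10 w20] Ww [w1M w2B]]]] := decomposition k.
have rnu0 : 0 <= nu - r by rewrite subr_ge0 ltW.
apply: (@le_trans _ _ (\int[mu]_x ((2 `^ nu)%:E *
   ((K%:R `^ (nu - r))%:E * (w1 x `^ r)%:E + (w2 x `^ nu)%:E)))%E).
  apply: ae_ge0_le_integral => //.
  - by move=> x _; rewrite lee_fin powR_ge0.
  - by apply: (mpow (fun x => Num.min (W x) K%:R)); exact: measurable_minr.
  - by move=> x _; rewrite mule_ge0 ?adde_ge0 ?mule_ge0 ?lee_fin ?powR_ge0.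
  - apply: emeasurable_funM => //; apply: emeasurable_funD; last exact: mpow.
    by apply: emeasurable_funM => //; exact: mpow.
  apply: filterS Ww => x Wx _.
  rewrite -[X in (_ <= _ * (X + _))%E]EFinM -EFinD -EFinM lee_fin.
  have min0 : 0 <= Num.min (w1 x) K%:R by rewrite le_min w10 ler0n.
  (* Truncating [w1] alone suffices, and [min w1 K ^ nu <= K ^ (nu - r) * w1 ^ r] trades the
     exponent [nu] for [r]. *)
  apply: (@le_trans _ _ ((Num.min (w1 x) K%:R + w2 x) `^ nu)).
    rewrite ler_powR2l ?(ltW nu0) ?le_min ?W0 ?ler0n//.
    rewrite ge_min; have [w1K|w1K] := leP (w1 x) K%:R.
      by rewrite Wx.
    by rewrite orbC lerDl w20.
  apply: le_trans (powRD_le _ _ _ (ltW nu0) min0 (w20 x)) _.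
  rewrite ler_wpM2l ?powR_ge0// lerD2r.
  have [->|mn0] := eqVneq (Num.min (w1 x) K%:R) 0.
    by rewrite powR0 ?gt_eqF// mulr_ge0 ?powR_ge0.
  have mp : 0 < Num.min (w1 x) K%:R by rewrite lt_neqAle eq_sym mn0.
  set z := Num.min _ _ in mp *.
  have -> : z `^ nu = z `^ (nu - r) * z `^ r by rewrite -powRDpos// subrK.
  rewrite ler_pM ?powR_ge0//.
    by rewrite ler_powR2l ?(ltW mp)// ge_min lexx orbT.
  by rewrite ler_powR2l ?(ltW r0) ?(ltW mp)// ge_min lexx.
rewrite ge0_integralZl_EFin ?powR_ge0//; last 2 first.
- by move=> x _; rewrite adde_ge0 ?mule_ge0 ?lee_fin ?powR_ge0.
- apply: emeasurable_funD; last exact: mpow.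
  by apply: emeasurable_funM => //; exact: mpow.
rewrite ge0_integralD//; last 4 first.
- by move=> x _; rewrite -EFinM lee_fin mulr_ge0 ?powR_ge0.
- by apply: emeasurable_funM => //; exact: mpow.
- by move=> x _; rewrite lee_fin powR_ge0.
- exact: mpow.
rewrite ge0_integralZl_EFin ?powR_ge0//; last 2 first.
- by move=> x _; rewrite lee_fin powR_ge0.
- exact: mpow.
rewrite EFinM lee_wpmul2l ?lee_fin ?powR_ge0// EFinD leeD//.
apply: (@le_trans _ _ ((K%:R `^ (nu - r))%:E * (M / 2 ^+ k)%:E)%E).
  by rewrite lee_wpmul2l// lee_fin powR_ge0.
by rewrite -EFinM lee_fin mulrA.
Qed.

End regularity_lifting.

(** * Localization: small sublevel sets of [N], the weight, and the abstract theorem *)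

Lemma integral_small_sets (f N : T -> R) (A : R) :
  measurable_fun setT f -> (forall x, 0 <= f x) ->
  (\int[mu]_x (f x)%:E < +oo)%E ->
  measurable_fun setT N -> mu [set x | N x <= 0]%R = 0%E -> 0 < A ->
  exists2 t : R, 0 < t &
    (\int[mu]_x (f x * \1_[set y | N y < t]%R x)%:E <= A%:E)%E.
Proof.
move=> mf f0 foo mN N0 A0.
(* Where [N > 0], a point eventually leaves [E k]; so [f] cut to [E k] tends to 0 almost everywhere,
   dominated by [f]. *)
pose E (k : nat) := [set y | N y < k.+1%:R^-1]%R.
have mE k : measurable (E k).
  rewrite [X in measurable X](_ : _ = N @^-1` `]-oo, k.+1%:R^-1[%classic); last first.
    by apply/seteqP; split => y /=; rewrite in_itv.
  by rewrite -[X in measurable X]setTI; exact: mN.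
pose g k x := (f x * \1_(E k) x)%:E.
have mg k : measurable_fun setT (g k).
  by apply/measurable_EFinP; apply: measurable_funM => //; exact: measurable_indic.
have cvg0 : {ae mu, forall x, setT x -> g ^~ x @ \oo --> 0%E}.
  exists [set x | N x <= 0]%R; split => //.
    rewrite [X in measurable X](_ : _ = N @^-1` `]-oo, 0]%classic); last first.
      by apply/seteqP; split => y /=; rewrite in_itv.
    by rewrite -[X in measurable X]setTI; exact: mN.
  move=> x /= h; rewrite leNgt; apply/negP => Nx; apply: h => _.
  apply: cvg_near_cst; near=> k.
  rewrite /g indicE memNset ?mulr0// /E /=; apply/negP; rewrite -leNgt.
  rewrite -[leRHS]invrK lef_pV2 ?posrE ?invr_gt0//.
  rewrite (@le_trans _ _ k%:R) ?ler_nat//.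
  by near: k; exact: nbhs_infty_ger.
have ig : mu.-integrable setT (EFin \o f).
  apply/integrableP; split; first exact/measurable_EFinP.
  by under eq_integral do rewrite gee0_abs ?lee_fin//.
have gf : {ae mu, forall x k, setT x -> (`|g k x| <= (EFin \o f) x)%E}.
  apply: nearW => x k _ /=; rewrite lee_fin normrM ger0_norm// indicE.
  by case: (x \in E k); rewrite ?normr1 ?normr0 ?mulr1 ?mulr0.
have [_ _] := dominated_convergence measurableT mg (measurable_cst _) cvg0 ig gf.
rewrite integral0 => cvgI.
have [k kA] : exists k, (\int[mu]_x g k x <= A%:E)%E.
  apply: contrapT => /forallNP h.
  suff : (A%:E <= 0)%E by rewrite lee_fin leNgt A0.
  apply: (cvge_to_ge cvgI); apply: nearW => k /=.
  by apply: ltW; rewrite ltNge; apply/negP.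
by exists k.+1%:R^-1.
Unshelve. all: by end_near. Qed.

Definition weight (N : T -> R) (t s : R) (y : T) : R := Num.max 0 (t - N y) `^ s.

(** From [t - N x <= (t - N y) + L m^(1/n)], the weight at [x] is at most [2^s] times the weight at
    [y] plus [L^s m^(s/n)]. Multiply by [u y * m^e] and integrate: the remainder raises the kernel
    exponent by [s / n]. *)
Lemma weighted_potential_le (u N : T -> R) (e n L s t : R) x :
  0 < n -> 0 <= L -> 0 <= s -> e != 0 ->
  measurable_fun setT u -> (forall x, 0 <= u x) -> measurable_fun setT N ->
  (forall x y, N y <= N x + L * m x y `^ n^-1) ->
  ((weight N t s x)%:E * potential u e x <=
   (2 `^ s)%:E * potential (fun y => weight N t s y * u y)%R e x +
   (2 `^ s * L `^ s)%:E * potential u (e + s / n)%R x)%E.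
Proof.
move=> n0 L0 s0 e0 umeas u0 mN NL; set w := weight N t s.
have w0 y : 0 <= w y by rewrite powR_ge0.
have mw : measurable_fun setT w.
  apply: measurable_fun_powR; apply: measurable_maxr => //.
  exact: measurable_funB.
have mpow p : measurable_fun setT (fun y => m x y `^ p).
  by apply: measurable_fun_powR; exact: mm1.
have k0 (v : T -> R) p : (forall y, 0 <= v y) ->
    forall y, setT y -> (0 <= (v y * m x y `^ p)%:E)%E.
  by move=> v0 y _; rewrite lee_fin mulr_ge0 ?powR_ge0.
have mk (v : T -> R) p : measurable_fun setT v ->
    measurable_fun setT (fun y => (v y * m x y `^ p)%:E).
  by move=> mv; apply/measurable_EFinP; exact: measurable_funM.
have wu0 y : 0 <= w y * u y by rewrite mulr_ge0.
have mwu : measurable_fun setT (fun y => w y * u y) by exact: measurable_funM.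
have c1 : 0 <= 2 `^ s * L `^ s by rewrite mulr_ge0 ?powR_ge0.
rewrite /potential -!ge0_integralZl_EFin ?powR_ge0//; try exact: mk; try exact: k0.
rewrite -ge0_integralD//; last 4 first.
- by move=> y _; rewrite -EFinM lee_fin !mulr_ge0 ?powR_ge0.
- by apply: emeasurable_funM => //; exact: mk.
- by move=> y _; rewrite -EFinM lee_fin !mulr_ge0 ?powR_ge0.
- by apply: emeasurable_funM => //; exact: mk.
apply: ge0_le_integral => //.
- by move=> y _; rewrite -EFinM lee_fin !mulr_ge0 ?powR_ge0.
- by apply: emeasurable_funM => //; exact: mk.
- by apply: emeasurable_funD; apply: emeasurable_funM => //; exact: mk.
move=> y _; rewrite -!EFinM -EFinD lee_fin.
(* On the diagonal [e != 0] makes [0 ^ e = 0], so the left side vanishes. *)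
have [m0|mn0] := eqVneq (m x y) 0.
  by rewrite m0 (powR0 e0) !mulr0 add0r !mulr_ge0 ?powR_ge0.
have mp : 0 < m x y by rewrite lt_neqAle eq_sym mn0/=.
have wxy : w x <= 2 `^ s * (w y + L `^ s * m x y `^ (s / n)).
  apply: (@le_trans _ _ ((Num.max 0 (t - N y) + L * m x y `^ n^-1) `^ s)).
    apply: ler_powR2l => //; first by rewrite le_max lexx.
    rewrite ge_max addr_ge0 ?le_max ?lexx ?mulr_ge0 ?powR_ge0//=.
    rewrite (@le_trans _ _ (t - N y + L * m x y `^ n^-1))//.
      by have := NL x y; lra.
    by rewrite lerD2r le_max lexx orbT.
  apply: le_trans (powRD_le _ _ _ s0 _ _) _.
  - by rewrite le_max lexx.
  - by rewrite mulr_ge0 ?powR_ge0.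
  by rewrite powRM ?powR_ge0// -powRrM [n^-1 * s]mulrC.
have -> : 2 `^ s * (w y * u y * m x y `^ e) +
    2 `^ s * L `^ s * (u y * m x y `^ (e + s / n)) =
    2 `^ s * (w y + L `^ s * m x y `^ (s / n)) * (u y * m x y `^ e).
  by rewrite powRDpos//; ring.
by rewrite ler_wpM2r// mulr_ge0 ?powR_ge0.
Qed.

(** Here [N] plays the norm and [m^(1/n)] the distance. [regularity_lifting] applies to [U] times
    the weight, and the weight is bounded below on a smaller sublevel set. *)
Lemma local_integrability (n al r nu L t0 : R) (N V U H : T -> R) :
  0 < n -> 0 < al < n -> n / (n - al) < r -> r < nu -> 0 < L -> 0 < t0 ->
  measurable_fun setT N -> mu [set x | N x <= 0]%R = 0%E ->
  (mu [set x | N x < t0]%R < +oo)%E ->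
  (forall x y, N y <= N x + L * m x y `^ n^-1) ->
  measurable_fun setT V -> (forall x, 0 <= V x) ->
  measurable_fun setT U -> (forall x, 0 <= U x) ->
  measurable_fun setT H -> (forall x, 0 <= H x) ->
  (\int[mu]_x (V x `^ (n / al))%:E < +oo)%E ->
  (\int[mu]_x (U x `^ r)%:E < +oo)%E ->
  (\int[mu]_x (H x `^ nu)%:E < +oo)%E ->
  {ae mu, forall x, N x < t0 -> ((U x)%:E <=
     potential (fun y => V y * U y)%R (al / n - 1)%R x + (H x)%:E)%E} ->
  exists2 t : R, 0 < t <= t0 &
    (\int[mu]_x (U x `^ nu * \1_[set y | N y < t]%R x)%:E < +oo)%E.
Proof.
move=> n0 /andP[al0 aln] nr rnu L0 t00 mN N0 Noo NL mV V0 mU U0 mH H0 Voo Uoo Hoo UVH.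
pose a := al / n.
have a0 : 0 < a by rewrite divr_gt0.
have aV : a^-1 = n / al by rewrite invf_div.
have nal : 0 < n - al by rewrite subr_gt0.
have r0 : 0 < r by apply: lt_trans nr; rewrite divr_gt0.
have nu0 : 0 < nu by exact: lt_trans rnu.
(* This is [n / (n - al) < r] rewritten as [1/r < 1 - a]. *)
have ar1 : a + r^-1 < 1.
  rewrite -ltrBrDl -[ltRHS]invrK ltf_pV2 ?posrE ?invr_gt0 ?subr_gt0//; last first.
    by rewrite /a ltr_pdivrMr// mul1r.
  rewrite (_ : 1 - a = (n - al) / n) ?invf_div//.
  by rewrite /a; field; rewrite gt_eqF.
have r1 : 1 < r.
  by apply: lt_trans nr; rewrite ltr_pdivlMr// mul1r ltrBlDr ltrDl.
have nu1 : 1 < nu by exact: lt_trans rnu.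
have rV0 : 0 < r^-1 by rewrite invr_gt0.
have nuV0 : 0 < nu^-1 by rewrite invr_gt0.
have nuV : nu^-1 < r^-1 by rewrite ltf_pV2.
have anu1 : a + nu^-1 < 1 by apply: lt_trans ar1; rewrite ltrD2l.
(* With this [s] the remainder kernel has exponent [a - 1 + s/n = a + 1/r - 1/nu - 1], for which
   [potential_mul_Lp] goes from [L^r] to [L^nu]. *)
pose s := n * (r^-1 - nu^-1).
have s0 : 0 < s by rewrite mulr_gt0// subr_gt0.
pose kappa : R := 2 `^ s.
have kappa0 : 0 < kappa by rewrite powR_gt0.
pose C1 := HLS_const (1 - r^-1) (a + r^-1).
pose C2 := HLS_const (1 - nu^-1) (a + nu^-1).
have C10 : 0 < C1 by exact: HLS_const_conj_gt0.
have C20 : 0 < C2 by exact: HLS_const_conj_gt0.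
(* The operator bounds on [L^r] and on [L^nu] both become at most 1/8; even after the factor [2^nu]
   there remains [(1/4)^nu <= 1/2]. *)
pose E := (8 * kappa * (C1 + C2))^-1.
have E0 : 0 < E by rewrite invr_gt0 !mulr_gt0// addr_gt0.
pose A := E `^ a^-1.
have A0 : 0 < A by rewrite powR_gt0.
have Aa : A `^ a = E by rewrite /A -powRrM mulVf ?gt_eqF// powRr1// ltW.
have small C : 0 < C -> C <= C1 + C2 -> kappa * C * A `^ a <= 8^-1.
  move=> C0 CC; rewrite Aa /E !invfM.
  have CC0 : 0 < C1 + C2 by rewrite addr_gt0.
  have -> : kappa * C * (8^-1 / kappa / (C1 + C2)) = 8^-1 * (C / (C1 + C2)).
    by field; rewrite !gt_eqF.
  by rewrite ler_piMr ?invr_ge0// ler_pdivrMr// mul1r.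
have mVa : measurable_fun setT (fun x => V x `^ a^-1) by exact: measurable_fun_powR.
have [t1 t10 Vt1] := integral_small_sets _ N _ mVa (fun=> powR_ge0 _ _)
  (etrans (congr1 (fun e => \int[mu]_x (V x `^ e)%:E < +oo)%E aV) Voo) mN N0 A0.
(* Below [t0] the inequality for [U] is available; below [t1] the integral of [V ^ (1/a)] is at most
   [A]. *)
pose t := Num.min t0 t1.
have tp : 0 < t by rewrite lt_min t00.
have measurable_sublevel e : measurable [set x | N x < e]%R.
  rewrite [X in measurable X](_ : _ = N @^-1` `]-oo, e[%classic); last first.
    by apply/seteqP; split => y /=; rewrite in_itv.
  by rewrite -[X in measurable X]setTI; exact: mN.
pose D := [set x | N x < t]%R.
have mD : measurable D by exact: measurable_sublevel.
have Doo : (mu D < +oo)%E.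
  apply: le_lt_trans Noo; apply: le_measure; rewrite ?inE// => x /= /lt_le_trans.
  by apply; rewrite ge_min lexx.
have m1D : measurable_fun setT (\1_D : T -> R) by exact: measurable_indic.
have D1 x : D x -> \1_D x = 1 :> R by move=> Dx; rewrite indicE mem_set.
have D0 x : ~ D x -> \1_D x = 0 :> R by move=> Dx; rewrite indicE memNset.
have [MV MV0 VMV] := integral_powR_lty _ _ _ _ _ _ Voo; rewrite -aV in VMV.
have [MU MU0 UMU] := integral_powR_lty _ _ _ _ _ _ Uoo.
have [MH MH0 HMH] := integral_powR_lty _ _ _ _ _ _ Hoo.
pose w := weight N t s.
have w0 x : 0 <= w x by rewrite powR_ge0.
have mw : measurable_fun setT w.
  apply: measurable_fun_powR; apply: measurable_maxr => //.
  exact: measurable_funB.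
have wD x : ~ D x -> w x = 0.
  move=> /negP; rewrite -leNgt => tN; rewrite /w /weight (max_idPl _) ?subr_le0//.
  by rewrite powR0 ?gt_eqF.
(* Since [N <= 0] only on a null set, [t - N <= t] and hence the weight is at most [t^s] almost
   everywhere. *)
have N_ge0 : {ae mu, forall x, 0 <= N x}.
  exists [set x | N x <= 0]%R; split => //.
    rewrite [X in measurable X](_ : _ = N @^-1` `]-oo, 0]%classic); last first.
      by apply/seteqP; split => y /=; rewrite in_itv.
    by rewrite -[X in measurable X]setTI; exact: mN.
  by move=> x /= /negP; rewrite -ltNge => /ltW.
have wt : {ae mu, forall x, w x <= t `^ s}.
  apply: filterS N_ge0 => x Nx; apply: ler_powR2l; first exact: ltW.
    by rewrite le_max lexx.
  by rewrite ge_max ltW//= lerBlDr lerDl.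
pose V1 x := V x * \1_D x.
have V10 x : 0 <= V1 x by rewrite mulr_ge0.
have mV1 : measurable_fun setT V1 by exact: measurable_funM.
have V1A : (\int[mu]_x (V1 x `^ a^-1)%:E <= A%:E)%E.
  apply: le_trans Vt1; apply: ge0_le_integral => //.
  - by move=> x _; rewrite lee_fin powR_ge0.
  - by apply/measurable_EFinP; exact: measurable_fun_powR.
  - by apply/measurable_EFinP; apply: measurable_funM.
  move=> x _; rewrite lee_fin /V1; have [Dx|Dx] := pselect (D x); last first.
    by rewrite D0// mulr0 powR0 ?mulr_ge0 ?powR_ge0// invr_eq0 gt_eqF.
  rewrite D1// mulr1 indicE mem_set ?mulr1//=.
  by apply: lt_le_trans Dx _; rewrite ge_min lexx orbT.
pose W x := w x * U x.
have W0 x : 0 <= W x by rewrite mulr_ge0.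
have mW : measurable_fun setT W by exact: measurable_funM.
have WD x : ~ D x -> W x = 0 by move=> Dx; rewrite /W wD// mul0r.
have mVU : measurable_fun setT (fun y => V y * U y) by exact: measurable_funM.
have VU0 y : 0 <= V y * U y by rewrite mulr_ge0.
pose e := a + r^-1 - nu^-1 - 1.
have eE : a - 1 + s / n = e by rewrite /e /s; field; rewrite !gt_eqF.
(* The remainder of [weighted_potential_le], restricted to [D]. It involves the full [V], whose norm
   is finite but not small. *)
pose far x := fine (potential (fun y => V y * U y)%R e x) * \1_D x.
have far0 x : 0 <= far x by rewrite mulr_ge0// fine_ge0// potential_ge0.
have mfar : measurable_fun setT far.
  apply: measurable_funM => //.
  by apply: (measurableT_comp (fine_measurable _)) => //; exact: measurable_potential.
have farD x : ~ D x -> far x = 0 by move=> Dx; rewrite /far D0// mulr0.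
have far_le x : ((far x)%:E <= potential (fun y => V y * U y)%R e x)%E.
  have : (0 <= potential (fun y => V y * U y)%R e x)%E by exact: potential_ge0.
  rewrite /far indicE; case: (x \in D); rewrite ?mulr0// mulr1.
  by case: (potential _ _ _) => [z|_|//] //=; exact: leey.
have nuar : nu^-1 < a + r^-1 by rewrite (lt_le_trans nuV)// lerDr ltW.
have far_nu := potential_mul_Lp D V a MV mD Doo mV V0 a0 MV0 VMV U far nu r MU
  r0 nu1 ar1 nuar MU0 mU U0 UMU mfar far0 farD far_le.
have far_fin := potential_mul_ae_fin_num D V a MV mD Doo mV V0 a0 MV0 VMV U nu r MU
  r0 nu1 ar1 nuar MU0 mU U0 UMU.
rewrite -/e in far_fin.
pose K := kappa * L `^ s.
have K0 : 0 <= K := mulr_ge0 (ltW kappa0) (powR_ge0 _ _).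
pose H1 x := K * far x + w x * H x.
have H10 x : 0 <= H1 x.
  exact: addr_ge0 (mulr_ge0 K0 (far0 x)) (mulr_ge0 (w0 x) (H0 x)).
have mH1 : measurable_fun setT H1.
  by apply: measurable_funD; apply: measurable_funM.
have scale_lty (f g : T -> R) k p : 0 <= k -> 0 <= p ->
    measurable_fun setT f -> measurable_fun setT g ->
    (forall x, 0 <= f x) -> (forall x, 0 <= g x) ->
    {ae mu, forall x, f x <= k * g x} ->
    (\int[mu]_x (g x `^ p)%:E < +oo)%E -> (\int[mu]_x (f x `^ p)%:E < +oo)%E.
  move=> k0 p0 mf mg f0 g0 fg goo.
  apply: (@le_lt_trans _ _ (\int[mu]_x ((k `^ p)%:E * (g x `^ p)%:E))%E).
    apply: ae_ge0_le_integral => //.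
    - by move=> x _; rewrite lee_fin powR_ge0.
    - by apply/measurable_EFinP; exact: measurable_fun_powR.
    - by move=> x _; rewrite -EFinM lee_fin mulr_ge0 ?powR_ge0.
    - apply/measurable_EFinP; apply: measurable_funM => //.
      exact: measurable_fun_powR.
    apply: filterS fg => x fg _.
    by rewrite -EFinM lee_fin -powRM// ler_powR2l.
  rewrite ge0_integralZl_EFin ?powR_ge0//; last 2 first.
  - by move=> x _; rewrite lee_fin powR_ge0.
  - by apply/measurable_EFinP; exact: measurable_fun_powR.
  by rewrite lte_mul_pinfty// lee_fin powR_ge0.
have ts0 : 0 <= t `^ s by rewrite powR_ge0.
have Woo : (\int[mu]_x (W x `^ r)%:E < +oo)%E.
  apply: (scale_lty W U _ _ ts0 (ltW r0)) => //.
  by apply: filterS wt => x wt; rewrite /W ler_wpM2r.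
have H1oo : (\int[mu]_x (H1 x `^ nu)%:E < +oo)%E.
  have mwH : measurable_fun setT (fun x => w x * H x) by exact: measurable_funM.
  have wH0 x : 0 <= w x * H x by rewrite mulr_ge0.
  have mKf : measurable_fun setT (fun x => K * far x) by exact: measurable_funM.
  have Kf0 x : 0 <= K * far x by rewrite mulr_ge0.
  have wHoo : (\int[mu]_x ((w x * H x) `^ nu)%:E < +oo)%E.
    apply: (scale_lty _ H _ _ ts0 (ltW nu0)) => //.
    by apply: filterS wt => x wt; rewrite ler_wpM2r.
  have Kfoo : (\int[mu]_x ((K * far x) `^ nu)%:E < +oo)%E.
    apply: (scale_lty (fun x => K * far x) far K nu K0 (ltW nu0) mKf mfar Kf0 far0).
      by apply: nearW => x; exact: lexx.
    exact: le_lt_trans far_nu (ltry _).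
  have mp (f : T -> R) : measurable_fun setT f -> measurable_fun setT (fun x => (f x `^ nu)%:E).
    by move=> mf; apply/measurable_EFinP; exact: measurable_fun_powR.
  apply: (@le_lt_trans _ _ (\int[mu]_x ((2 `^ nu)%:E *
      (((K * far x) `^ nu)%:E + ((w x * H x) `^ nu)%:E)))%E).
    apply: ge0_le_integral => //.
    - by move=> x _; rewrite lee_fin powR_ge0.
    - exact: mp.
    - by apply: emeasurable_funM => //; apply: emeasurable_funD; exact: mp.
    by move=> x _; rewrite -EFinD -EFinM lee_fin powRD_le// ltW.
  rewrite ge0_integralZl_EFin ?powR_ge0//; last 2 first.
  - by move=> x _; rewrite -EFinD lee_fin addr_ge0 ?powR_ge0.
  - by apply: emeasurable_funD; exact: mp.
  rewrite ge0_integralD//; last 4 first.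
  - by move=> x _; rewrite lee_fin powR_ge0.
  - exact: mp.
  - by move=> x _; rewrite lee_fin powR_ge0.
  - exact: mp.
  apply: lte_mul_pinfty; [by rewrite lee_fin powR_ge0|by []|].
  exact: lte_add_pinfty Kfoo wHoo.
have WH1 : {ae mu, forall x, D x -> ((W x)%:E <=
    kappa%:E * potential (fun y => V1 y * W y)%R (a - 1)%R x + (H1 x)%:E)%E}.
  apply: filterS2 far_fin UVH => x far_fin UVH Dx.
  have am1 : a - 1 != 0.
    by rewrite ltr0_neq0// subr_lt0 (lt_trans _ ar1)// ltrDl.
  have /= := weighted_potential_le (fun y => V y * U y) N (a - 1) n L s t x n0
    (ltW L0) (ltW s0) am1 mVU VU0 mN NL.
  rewrite eE -/w -/kappa -/K.
  (* The weight vanishes off [D], so in this term [V] may be replaced by its small restriction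
     [V1]. *)
  have -> : (fun y => w y * (V y * U y)) = (fun y => V1 y * W y).
    apply/funext => y; rewrite /V1 /W; have [Dy|Dy] := pselect (D y).
      by rewrite D1// mulr1 mulrCA.
    by rewrite wD// !mul0r mulr0.
  have -> : (K%:E * potential (fun y => V y * U y)%R e x = (K * far x)%:E)%E.
    by rewrite /far D1// mulr1 (EFinM K) fineK// far_fin.
  move=> wle.
  have /UVH {UVH} Ux : N x < t0 by apply: lt_le_trans Dx _; rewrite ge_min lexx.
  rewrite /W [leLHS]EFinM.
  apply: (@le_trans _ _ ((w x)%:E *
    (potential (fun y => V y * U y)%R (a - 1)%R x + (H x)%:E))%E).
    by rewrite lee_wpmul2l// lee_fin.
  rewrite ge0_muleDr ?lee_fin//; last exact: potential_ge0.
  by rewrite /H1 EFinD [X in (_ <= _ + (_ + X))%E]EFinM addeA leeD2r.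
have Wnu : (\int[mu]_x (W x `^ nu)%:E < +oo)%E.
  apply: (regularity_lifting D V1 a A kappa mD Doo mV1 V10 a0 A0 V1A (ltW kappa0)
    W H1 r nu) => //.
  - have h : kappa * C1 * A `^ a <= 8^-1 by apply: small; rewrite ?lerDl// ltW.
    apply: (@le_trans _ _ (8^-1 `^ r)).
      by rewrite ler_powR2l ?(ltW r0)// !mulr_ge0 ?powR_ge0// ltW.
    rewrite (@le_trans _ _ 8^-1)//; last by rewrite lef_pV2 ?posrE// ler_nat.
    by rewrite ge1r_powR ?(ltW r1)// invr_gt0 invf_le1// ltr0n ler1n.
  - have h : kappa * C2 * A `^ a <= 8^-1 by apply: small; rewrite ?lerDr// ltW.
    have kC0 : 0 <= kappa * C2 * A `^ a by rewrite !mulr_ge0 ?powR_ge0// ltW.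
    rewrite -powRM//.
    apply: (@le_trans _ _ (4^-1 `^ nu)).
      apply: ler_powR2l; [exact: ltW|exact: (mulr_ge0 (ler0n _ _) kC0)|].
      have -> : 4^-1 = 2 * 8^-1 :> R by field.
      by rewrite ler_wpM2l.
    rewrite (@le_trans _ _ 4^-1)//; last by rewrite lef_pV2 ?posrE// ler_nat.
    by rewrite ge1r_powR ?(ltW nu1)// invr_gt0 invf_le1// ltr0n ler1n.
(* Where [N < t / 2] the weight is at least [(t / 2)^s], so [U] is at most a constant times [W]. *)
exists (t / 2).
  rewrite divr_gt0//= (@le_trans _ _ t)//; last by rewrite ge_min lexx.
  by rewrite ler_pdivrMr// ler_peMr ?ler1n// ltW.
pose U1 x := U x * \1_[set y | N y < t / 2]%R x.
have U10 x : 0 <= U1 x by rewrite mulr_ge0.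
have mU1 : measurable_fun setT U1.
  by apply: measurable_funM.
have t20 : 0 < (t / 2) `^ s by apply: powR_gt0; rewrite divr_gt0.
rewrite (eq_integral (fun x => (U1 x `^ nu)%:E)); last first.
  move=> x _; rewrite /U1 indicE; case: (x \in _); rewrite ?mulr1//.
  by rewrite !mulr0 powR0// gt_eqF.
apply: (scale_lty U1 W ((t / 2) `^ s)^-1 nu) => //; rewrite ?invr_ge0 ?ltW//.
apply: nearW => x; rewrite ler_pdivlMl// /U1 indicE.
have [/set_mem/= Nx|_] := boolP (x \in _); last by rewrite !mulr0.
rewrite mulr1 /W ler_wpM2r// /w /weight ler_powR2l ?(ltW s0)//.
  by rewrite divr_ge0// ltW.
by rewrite le_max; apply/orP; right; rewrite lerBrDl [leRHS]splitr lerD2r ltW.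
Qed.

End fractional_integral.

(** * Euclidean geometry: norms, distance, balls and cubes *)

Lemma measurable_fun_sumr d (T : measurableType d) (R : realType) (I : Type)
    (s : seq I) (f : I -> T -> R) :
  (forall i, measurable_fun setT (f i)) ->
  measurable_fun setT (fun x => \sum_(i <- s) f i x).
Proof.
move=> mf; elim: s => [|i s IHs].
  by under eq_fun do rewrite big_nil; exact: measurable_cst.
by under eq_fun do rewrite big_cons; exact: measurable_funD.
Qed.

Section euclidean_geometry.
Context {R : realType} {n : nat}.
Implicit Types x y : Rn R n.

(** It serves as [N] in the weight: its triangle inequality is checked coordinatewise, and it is
    comparable to [eucl_norm] up to the factor [n]. *)
Definition norm1 x : R := \sum_(i < n) `|tnth x i : R|.

Lemma norm1_ge0 x : 0 <= norm1 x.
Proof. by apply: sumr_ge0 => i _. Qed.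

Lemma eucl_norm_ge0 x : 0 <= eucl_norm x.
Proof. exact: sqrtr_ge0. Qed.

Lemma ler_coord_eucl_norm x i : `|tnth x i : R| <= eucl_norm x.
Proof.
rewrite -sqrtr_sqr ler_wsqrtr// (bigD1 i)//= lerDl sumr_ge0// => j _.
exact: sqr_ge0.
Qed.

(** Each square [x_i ^ 2] is at most [|x_i| * norm1 x]; sum over [i]. *)
Lemma eucl_norm_le_norm1 x : eucl_norm x <= norm1 x.
Proof.
rewrite -[leRHS]ger0_norm ?norm1_ge0// -sqrtr_sqr ler_wsqrtr//.
rewrite expr2 {1}/norm1 mulr_suml ler_sum// => i _.
rewrite -real_normK ?num_real// expr2 ler_wpM2l//.
by rewrite /norm1 (bigD1 i)//= lerDl sumr_ge0.
Qed.

Lemma norm1_le_eucl_norm x : norm1 x <= n%:R * eucl_norm x.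
Proof.
have -> : n%:R * eucl_norm x = \sum_(i < n) eucl_norm x.
  by rewrite sumr_const card_ord mulr_natl.
apply: ler_sum => i _.
exact: ler_coord_eucl_norm.
Qed.

Lemma norm1_triangle x y : norm1 y <= norm1 x + n%:R * eucl_dist x y.
Proof.
apply: le_trans (lerD (lexx _) (norm1_le_eucl_norm _)).
rewrite /norm1 -big_split/= ler_sum// => i _; rewrite tnth_mktuple.
have := ler_normB (tnth x i : R) (tnth x i - tnth y i : R).
by rewrite opprB addrCA subrr addr0.
Qed.

Lemma eucl_distC x y : eucl_dist x y = eucl_dist y x.
Proof.
rewrite /eucl_dist /eucl_norm; congr (Num.sqrt _); apply: eq_bigr => i _.
by rewrite !tnth_mktuple -sqrrN opprB.
Qed.

Lemma measurable_coord i : measurable_fun setT (fun x : Rn R n => tnth x i : R).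
Proof. exact: measurable_tnth. Qed.

Lemma measurable_norm1 : measurable_fun setT norm1.
Proof.
apply: measurable_fun_sumr => i.
by apply: measurableT_comp => //; exact: measurable_coord.
Qed.

Lemma measurable_eucl_dist :
  measurable_fun setT (fun z : Rn R n * Rn R n => eucl_dist z.1 z.2).
Proof.
(* The square root is written as the power 1/2, so that measurability follows from that of
   [powR]. *)
rewrite [X in measurable_fun _ X](_ : _ = fun z : Rn R n * Rn R n =>
    (\sum_(i < n) (tnth z.1 i - tnth z.2 i : R) ^+ 2) `^ 2^-1); last first.
  apply/funext => z; rewrite powR12_sqrt; last first.
    by apply: sumr_ge0 => i _; exact: sqr_ge0.
  by congr (Num.sqrt _); apply: eq_bigr => i _; rewrite tnth_mktuple.
apply: measurable_fun_powR; apply: measurable_fun_sumr => i.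
apply: measurable_funX; apply: measurable_funB.
- exact: (measurableT_comp (measurable_coord i) measurable_fst).
- exact: (measurableT_comp (measurable_coord i) measurable_snd).
Qed.

Lemma eucl_dist0 x : eucl_dist [tuple 0 | i < n] x = eucl_norm x.
Proof.
rewrite /eucl_dist /eucl_norm; congr (Num.sqrt _); apply: eq_bigr => i _.
by rewrite !tnth_mktuple sub0r sqrrN.
Qed.

Lemma measurable_eucl_norm : measurable_fun setT (@eucl_norm R n).
Proof.
rewrite [X in measurable_fun _ X](_ : _ = eucl_dist [tuple 0 | i < n]).
  exact: (measurableT_comp measurable_eucl_dist (measurable_pair1 _)).
by apply/funext => x; rewrite eucl_dist0.
Qed.

Lemma measurable_eucl_ball t : measurable (eucl_ball n t : set (Rn R n)).
Proof.
rewrite [X in measurable X](_ : _ = @eucl_norm R n @^-1` `]-oo, t[%classic).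
  by rewrite -[X in measurable X]setTI; exact: measurable_eucl_norm.
by apply/seteqP; split => y /=; rewrite in_itv.
Qed.

(** The cube circumscribed about the ball of radius [t]; its measure, read off the box formula,
    bounds that of the ball. *)
Definition cube x (t : R) : set (Rn R n) :=
  [set y | forall i, `](tnth x i - t), (tnth x i + t)[%classic (tnth y i : R)].

Lemma measurable_cube x t : measurable (cube x t).
Proof.
rewrite [X in measurable X](_ : _ = \bigcap_(i in [set: 'I_n])
  (fun y : Rn R n => tnth y i) @^-1` `](tnth x i - t), (tnth x i + t)[%classic).
  apply: fin_bigcap_measurable => [|i _]; first exact: finite_finset.
  by rewrite -[X in measurable X]setTI; exact: measurable_tnth.
apply/seteqP; split => y /= yx i; first by move=> _; exact: yx.
exact: (yx i I).
Qed.

Lemma lebesgue_cube x t : 0 <= t ->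
  (lebesgue_rn n (cube x t) = ((2 * t) ^+ n)%:E)%E.
Proof.
move=> t0; rewrite (@lebesgue_rn_box R n (fun i : 'I_n =>
  `](tnth x i - t), (tnth x i + t)[%classic : set (measurableTypeR R)))//.
rewrite (eq_bigr (fun=> (2 * t)%:E)); last first.
  move=> i _; rewrite lebesgue_measure_itv/= lte_fin.
  case: ltP => [_|]; first by rewrite -EFinB; congr EFin; ring.
  move=> h; have -> : t = 0 by apply/eqP; rewrite eq_le t0 andbT; lra.
  by rewrite mulr0.
by rewrite prodEFin prodr_const card_ord.
Qed.

Lemma eucl_dist_cube x y t : eucl_dist x y < t -> cube x t y.
Proof.
move=> xyt i /=; rewrite in_itv/=.
have := le_lt_trans (ler_coord_eucl_norm _ i) xyt.
by rewrite tnth_mktuple ltr_norml => /andP[? ?]; apply/andP; split; lra.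
Qed.

Lemma lebesgue_rn_sigma_finite : sigma_finite setT (@lebesgue_rn R n).
Proof.
exists (fun k => cube [tuple 0 | i < n] k%:R).
  apply/esym/seteqP; split => // x _.
  exists (Num.truncn (eucl_norm x)).+1 => //.
  by apply: eucl_dist_cube; rewrite eucl_dist0 truncnS_gt.
move=> k; split; first exact: measurable_cube.
by rewrite lebesgue_cube ?ltry.
Qed.

End euclidean_geometry.

(* [Measure.sort (lebesgue_rn n)] itself, with its sigma-finiteness packed, so
   that statements about either measure are convertible. *)
Definition lebesgue_rn_sf (R : realType) (n : nat) :
    {sigma_finite_measure set (Rn R n) -> \bar R} :=
  HB.pack_for (SigmaFiniteMeasure.type (Rn R n) R)
    (Measure.sort (@lebesgue_rn R n))
    (isSFinite.Build _ _ _ _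
      (sfinite_measure_sigma_finite (@lebesgue_rn_sigma_finite R n)))
    (isSigmaFinite.Build _ _ _ _ (@lebesgue_rn_sigma_finite R n)).

(** * Measure estimates for the kernel [|x - y| ^ n] and for [norm1] *)

Section lebesgue_dist_power.
Context {R : realType} {n : nat}.
Hypothesis n_gt0 : (0 < n)%N.
Implicit Types x y : Rn R n.
Let nR : n%:R != 0 :> R.
Proof. by rewrite pnatr_eq0 -lt0n. Qed.

Lemma eucl_dist_expn x y p :
  (eucl_dist x y ^+ n) `^ p = eucl_dist x y `^ (n%:R * p).
Proof. by rewrite -powR_mulrn ?eucl_norm_ge0// powRrM. Qed.

Lemma eucl_dist_expn_root x y : (eucl_dist x y ^+ n) `^ n%:R^-1 = eucl_dist x y.
Proof. by rewrite eucl_dist_expn mulfV// powRr1// eucl_norm_ge0. Qed.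

Lemma measurable_eucl_dist_expn : measurable_fun setT
  (fun z : Rn R n * Rn R n => eucl_dist z.1 z.2 ^+ n).
Proof. by apply: measurable_funX; exact: measurable_eucl_dist. Qed.

Let measurable_dist_ball x t : measurable [set y | eucl_dist x y ^+ n < t].
Proof.
rewrite [X in measurable X](_ : _ =
    (fun y => eucl_dist x y ^+ n) @^-1` `]-oo, t[%classic); last first.
  by apply/seteqP; split => y /=; rewrite in_itv.
rewrite -[X in measurable X]setTI.
exact: (measurableT_comp measurable_eucl_dist_expn (measurable_pair1 x)).
Qed.

(** The ball has radius [t^(1/n)], and the cube around it has side [2 t^(1/n)]. *)
Lemma lebesgue_dist_ball x t : 0 < t ->
  (lebesgue_rn n [set y | eucl_dist x y ^+ n < t]%R <= (2 ^+ n * t)%:E)%E.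
Proof.
move=> t0; have t0' := ltW t0.
have -> : 2 ^+ n * t = (2 * t `^ n%:R^-1) ^+ n.
  by rewrite exprMn -[(t `^ _) ^+ n]powR_mulrn ?powR_ge0// -powRrM mulVf// powRr1.
rewrite -(@lebesgue_cube R n x) ?powR_ge0//.
apply: le_measure; rewrite ?inE//; first exact: measurable_cube.
move=> y /= yt; apply: eucl_dist_cube.
rewrite -[ltLHS]eucl_dist_expn_root gt0_ltr_powR ?nnegrE ?exprn_ge0 ?eucl_norm_ge0//.
by rewrite invr_gt0 ltr0n.
Qed.

Let measurable_norm1_itv (i : interval R) :
  measurable (@norm1 R n @^-1` [set` i]).
Proof. by rewrite -[X in measurable X]setTI; exact: measurable_norm1. Qed.

Let eucl_dist_origin x : eucl_dist [tuple 0 | i < n] x ^+ n <= norm1 x ^+ n.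
Proof.
by rewrite eucl_dist0 lerXn2r ?nnegrE ?eucl_norm_ge0 ?norm1_ge0// eucl_norm_le_norm1.
Qed.

(** The set lies in every ball around the origin, and these have arbitrarily small measure. *)
Lemma lebesgue_norm1_le0 : lebesgue_rn n [set x : Rn R n | norm1 x <= 0] = 0%E.
Proof.
apply/eqP; rewrite eq_le measure_ge0 andbT; apply/lee_addgt0Pr => e e0.
rewrite add0e.
have e2 : 0 < e / 2 ^+ n by rewrite divr_gt0 ?exprn_gt0.
have := lebesgue_dist_ball [tuple 0 | i < n] _ e2.
rewrite mulrCA divff ?gt_eqF ?exprn_gt0// mulr1; apply: le_trans.
apply: le_measure; rewrite ?inE//.
  exact: (measurable_norm1_itv `]-oo, 0]).
move=> x /= x0; apply: le_lt_trans (eucl_dist_origin x) _.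
have -> : norm1 x = 0 by apply/eqP; rewrite eq_le x0 norm1_ge0.
by rewrite expr0n eqn0Ngt n_gt0.
Qed.

Lemma lebesgue_norm1_lty t : 0 < t ->
  (lebesgue_rn n [set x : Rn R n | norm1 x < t]%R < +oo)%E.
Proof.
move=> t0.
have t1 : 0 < t ^+ n by rewrite exprn_gt0.
apply: le_lt_trans (ltry _).
apply: le_trans (lebesgue_dist_ball [tuple 0 | i < n] _ t1).
apply: le_measure; rewrite ?inE//.
  exact: (measurable_norm1_itv `]-oo, t[).
move=> x /= xt; apply: le_lt_trans (eucl_dist_origin x) _.
by rewrite ltrXn2r ?norm1_ge0 ?(ltW t0)// gtn_eqF.
Qed.

End lebesgue_dist_power.

(** * From the abstract setting to the theorem in Euclidean space *)

Lemma Lp_onP (R : realType) (n : nat) (p : R) (A : set (Rn R n)) (f : Rn R n -> R) :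
  0 < p ->
  Lp_on p A f <-> measurable_fun setT (f \_ A) /\
    (\int[lebesgue_rn n]_x (`|(f \_ A) x| `^ p)%:E < +oo)%E.
Proof.
move=> p0; rewrite /Lp_on.
have E : (\int[lebesgue_rn n]_x (`|(f \_ A) x| `^ p)%:E =
    \int[lebesgue_rn n]_x (`|(EFin \o f \_ A) x| `^ p))%E by [].
split.
  move=> /andP[]; rewrite !inE => mf; rewrite /= /finite_norm => fp; split => //.
  by rewrite E -powR_Lnorm ?gt_eqF// poweR_lty.
move=> [mf fp]; apply/andP; rewrite !inE; split => //=.
by rewrite /finite_norm unlock -E poweR_lty.
Qed.

(** Compare through [f <= f^+ <= g]: the negative part of [f] only lowers its integral. This covers
    an integrand [V u] without a sign at every point. *)
Lemma integral_le_ge0 d (T : measurableType d) (R : realType)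
    (mu : {measure set T -> \bar R}) (D : set T) (f g : T -> \bar R) :
  measurable D -> measurable_fun D f -> measurable_fun D g ->
  (forall x, D x -> 0 <= g x)%E -> (forall x, D x -> f x <= g x)%E ->
  (\int[mu]_(x in D) f x <= \int[mu]_(x in D) g x)%E.
Proof.
move=> mD mf mg g0 fg; rewrite integralE.
apply: (@le_trans _ _ (\int[mu]_(x in D) f^\+ x)%E).
  by rewrite -[leRHS]sube0 leeB// integral_ge0.
apply: ge0_le_integral => //; first exact: measurable_funepos.
by move=> x Dx; rewrite funeposE ge_max fg// g0.
Qed.

(** The clause [eps <= R2] keeps the ball inside the domain on which [u] is given. *)
Theorem corollary1p1 (R : realType) (n : nat) (alpha nu r R1 R2 : R)
    (V h u : Rn R n -> R) :
  (1 <= n)%N ->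
  0 < alpha < n%:R ->
  n%:R / (n%:R - alpha) < r ->
  r < nu ->
  0 < R1 < R2 ->
  Lp_on (n%:R / alpha) (eucl_ball n R2) V ->
  {ae lebesgue_rn n, forall x, eucl_ball n R2 x -> 0 <= V x} ->
  Lp_on nu (eucl_ball n R1) h ->
  Lp_on r (eucl_ball n R2) u ->
  {ae lebesgue_rn n, forall x, eucl_ball n R2 x -> 0 <= u x} ->
  {ae lebesgue_rn n, forall x, eucl_ball n R1 x ->
    ((u x)%:E <= \int[lebesgue_rn n]_(y in eucl_ball n R2)
       (V y * u y / eucl_dist x y `^ (n%:R - alpha))%:E + (h x)%:E)%E} ->
  exists eps : R, 0 < eps <= R2 /\ Lp_on nu (eucl_ball n eps) u.
Proof.
move=> n1 alphan nr rnu /andP[R10 R12] VL _ hL uL u0 uVh.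
have [alpha0 alphan'] := andP alphan.
have n0 : 0 < n%:R :> R by rewrite ltr0n.
have r0 : 0 < r by apply: lt_trans nr; rewrite divr_gt0// subr_gt0.
have nu0 : 0 < nu by exact: lt_trans rnu.
have na0 : 0 < n%:R / alpha by rewrite divr_gt0.
have [mV Voo] := (Lp_onP R n (n%:R / alpha) (eucl_ball n R2) V na0).1 VL.
have [mu Uoo] := (Lp_onP R n r (eucl_ball n R2) u r0).1 uL.
have [mh Hoo] := (Lp_onP R n nu (eucl_ball n R1) h nu0).1 hL.
(* Absolute values of the extensions by zero are nonnegative and measurable everywhere, as
   [local_integrability] asks. *)
pose V' x := `|(V \_ (eucl_ball n R2)) x|.
pose U' x := `|(u \_ (eucl_ball n R2)) x|.
pose H' x := `|(h \_ (eucl_ball n R1)) x|.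
have mV' : measurable_fun setT V' by exact: measurableT_comp.
have mU' : measurable_fun setT U' by exact: measurableT_comp.
have mH' : measurable_fun setT H' by exact: measurableT_comp.
pose m (x y : Rn R n) := eucl_dist x y ^+ n.
have m0 x y : 0 <= m x y by rewrite exprn_ge0// eucl_norm_ge0.
have mC x y : m x y = m y x by rewrite /m eucl_distC.
have mD := @measurable_eucl_ball R n R2.
have VU0 y : 0 <= V' y * U' y := mulr_ge0 (normr_ge0 _) (normr_ge0 _).
have U'V'H' : {ae lebesgue_rn n, forall x, norm1 x < R1 -> ((U' x)%:E <=
    potential _ _ R (lebesgue_rn_sf R n) m (fun y => V' y * U' y)%R
      (alpha / n%:R - 1)%R x + (H' x)%:E)%E}.
  apply: filterS2 u0 uVh => x u0 uVh xR1.
  have xB1 : eucl_ball n R1 x by apply: le_lt_trans xR1; exact: eucl_norm_le_norm1.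
  have xB2 : eucl_ball n R2 x by exact: lt_trans xB1 R12.
  have -> : U' x = u x by rewrite /U' patchE mem_set// ger0_norm// u0.
  apply: le_trans (uVh xB1) _; apply: leeD; last first.
    by rewrite /H' patchE mem_set// lee_fin ler_norm.
  (* Extended by zero, the integrand is at most [V' U'] times the kernel, since
     [n (alpha/n - 1) = -(n - alpha)]. *)
  rewrite integral_mkcond; apply: integral_le_ge0 => //.
  - rewrite [X in measurable_fun _ X](_ : _ = fun y => ((V \_ (eucl_ball n R2)) y *
        (u \_ (eucl_ball n R2)) y / eucl_dist x y `^ (n%:R - alpha))%:E).
      apply/measurable_EFinP; apply: measurable_funM.
        exact: measurable_funM.
      rewrite [X in measurable_fun _ X](_ : _ =
          fun y => eucl_dist x y `^ (- (n%:R - alpha))).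
        apply: measurable_fun_powR.
        exact: (measurableT_comp measurable_eucl_dist (measurable_pair1 x)).
      by apply/funext => y; rewrite powRN.
    apply/funext => y; rewrite !patchE; case: ifPn => // _.
    by rewrite mul0r mul0r.
  - apply/measurable_EFinP; apply: measurable_funM; first exact: measurable_funM.
    apply: measurable_fun_powR.
    exact: (measurableT_comp measurable_eucl_dist_expn (measurable_pair1 x)).
  - by move=> y _; rewrite lee_fin mulr_ge0 ?VU0 ?powR_ge0.
  move=> y _; rewrite patchE; case: ifPn => [yB|_]; last first.
    by rewrite lee_fin mulr_ge0 ?VU0 ?powR_ge0.
  rewrite lee_fin /V' /U' !patchE yB /m eucl_dist_expn.
  have -> : n%:R * (alpha / n%:R - 1) = - (n%:R - alpha).
    by rewrite mulrBr mulr1 mulrCA mulfV ?gt_eqF// mulr1 opprB.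
  by rewrite powRN -normrM ler_wpM2r ?invr_ge0 ?powR_ge0// ler_norm.
have c0 : 0 < 2 ^+ n :> R by rewrite exprn_gt0.
have norm1_m x y : norm1 y <= norm1 x + n%:R * m x y `^ n%:R^-1.
  by rewrite eucl_dist_expn_root// norm1_triangle.
have [t /andP[t0 tR1] Ut] := @local_integrability _ _ R (lebesgue_rn_sf R n) m
  (2 ^+ n) c0 m0 mC measurable_eucl_dist_expn
  (lebesgue_dist_ball n1) n%:R alpha r nu n%:R R1 norm1 V' U' H'
  n0 alphan nr rnu n0 R10 measurable_norm1 (lebesgue_norm1_le0 n1)
  (lebesgue_norm1_lty n1 _ R10) norm1_m mV' (fun=> normr_ge0 _)
  mU' (fun=> normr_ge0 _) mH' (fun=> normr_ge0 _) Voo Uoo Hoo U'V'H'.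
(* As [norm1 x <= n |x|], the Euclidean ball of radius [t / n] lies in the set where [norm1 < t]. *)
have eps0 : 0 < t / n%:R by rewrite divr_gt0.
have epsR2 : t / n%:R <= R2.
  rewrite (le_trans _ (ltW R12))// (le_trans _ tR1)// ler_pdivrMr//.
  by rewrite ler_peMr ?ler1n// ltW.
exists (t / n%:R); split; first by rewrite eps0.
have sub : eucl_ball n (t / n%:R) `<=` eucl_ball n R2.
  by move=> x /= /lt_le_trans; exact.
have mB := @measurable_eucl_ball R n (t / n%:R).
have uE : u \_ (eucl_ball n (t / n%:R)) =
    (u \_ (eucl_ball n R2)) \_ (eucl_ball n (t / n%:R)).
  apply/funext => x; rewrite !patchE; case: ifPn => // /set_mem /sub xB.
  by rewrite mem_set.
apply/(Lp_onP R n nu _ u nu0); split.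
  rewrite uE; apply/(measurable_restrictT _ mB).
  exact: measurable_funS mu.
apply: le_lt_trans Ut; apply: ge0_le_integral => //.
- apply/measurable_EFinP; apply: measurable_fun_powR; apply: measurableT_comp => //.
  rewrite uE; apply/(measurable_restrictT _ mB).
  exact: measurable_funS mu.
- apply/measurable_EFinP; apply: measurable_funM; first exact: measurable_fun_powR.
  apply: measurable_indic.
  rewrite [X in measurable X](_ : _ = norm1 @^-1` `]-oo, t[%classic).
    by rewrite -[X in measurable X]setTI; exact: measurable_norm1.
  by apply/seteqP; split => y /=; rewrite in_itv.
move=> x _; rewrite lee_fin uE patchE; case: ifPn => [xB|_]; last first.
  by rewrite normr0 powR0 ?gt_eqF// mulr_ge0 ?powR_ge0.
rewrite indicE mem_set ?mulr1//=; move/set_mem: xB; rewrite /eucl_ball /= => xB.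
apply: le_lt_trans (norm1_le_eucl_norm x) _.
by rewrite mulrC -ltr_pdivlMr.
Qed.
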